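(* Let $\mathcal{K}$ be a $2$-category with a rigid enhanced factorization system $(\mathcal{E},\mathcal{M})$ and let $\mathbb{T}$ be a $2$-monad on $\mathcal{K}$ which preserves $\mathcal{E}$ (if $e$ is a $1$-cell in $\mathcal{E}$, then so is $\mathbb{T}e$). Then the inclusion of $2$-categories $$\mathbb{J}\colon \mathbb{T}\text{-}\mathbf{AlgSt} \longrightarrow \mathbb{T}\text{-}\mathbf{PsAlg}$$ has a left $2$-adjoint $2$-functor $\mathbf{St}\colon \mathbb{T}\text{-}\mathbf{PsAlg}\to \mathbb{T}\text{-}\mathbf{AlgSt}$, and each component of the unit of the adjunction is an internal equivalence in $\mathbb{T}\text{-}\mathbf{PsAlg}$.
   Context: **Enhanced factorization systems.** Let $\mathcal{K}$ be a $2$-category. An enhanced factorization system (EFS) on $\mathcal{K}$ is a pair $(\mathcal{E},\mathcal{M})$ of classes of $1$-cells, both containing all isomorphisms, such that: (i) Every $1$-cell $f\colon X\to Y$ factors as $X\xrightarrow{e_f}\mathbb{I}f\xrightarrow{m_f}Y$ with $e_f\in\mathcal{E}$, $m_f\in\mathcal{M}$. (ii) Given $e\colon A\to X$ in $\mathcal{E}$, $m\colon B\to Y$ in $\mathcal{M}$, $1$-cells $v\colon A\to B$, $u\colon X\to Y$ and an invertible $2$-cell $\varphi\colon u\circ e\Rightarrow m\circ v$, there is a unique pair $(w,\widetilde\varphi)$ consisting of a $1$-cell $w\colon X\to B$ and an invertible $2$-cell $\widetilde\varphi\colon u\Rightarrow m\circ w$ such that $w\circ e=v$ and $\widetilde\varphi\circ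 e=\varphi$; if $\varphi$ is the identity, then $u=m\circ w$ and $\widetilde\varphi$ is the identity. (iii) With the notation of (ii), suppose $m\circ v=u\circ e$ and a second pair $v'\colon A\to B$, $u'\colon X\to Y$ is given with $m\circ v'=u'\circ e$, together with $2$-cells $\sigma\colon v\Rightarrow v'$, $\tau\colon u\Rightarrow u'$ with $\tau\circ e=m\circ\sigma$. Let $w,w'$ be the $1$-cells given by (ii). Then there is a unique $2$-cell $\rho\colon w\Rightarrow w'$ with $\rho\circ e=\sigma$ and $m\circ\rho=\tau$. The EFS is rigid if moreover: (iv) for $m\colon Y\to X$ in $\mathcal{M}$ and any $1$-cell $f\colon X\to Y$, if $m\circ f$ is isomorphic to $\mathrm{id}_X$ then $f\circ m$ is isomorphic to $\mathrm{id}_Y$. **$2$-monads and algebras.** A $2$-monad on $\mathcal{K}$ is a $\mathbf{Cat}$-enriched monad: a $2$-functor $\mathbb{T}\colon\mathcal{K}\to\mathcal{K}$ with $2$-natural transformations $\iota\colon \mathrm{Id}\to\mathbb{T}$, $\mu\colon\mathbb{T}\mathbb{T}\to\mathbb{T}$ strictly satisfying the unit and associativity laws. A (strict) $\mathbb{T}$-algebra is $(X,\theta)$ with $\theta\colon\mathbb{T}X\to X$, $\theta\circ\iota_X=\mathrm{id}$ and $\theta\circ\mathbb{T}\theta=\theta\circ\mu_X$. All $\mathbb{T}$-pseudoalgebras are normal: a $\mathbb{T}$-pseudoalgebra $(X,\theta,\varphi)$ is a $1$-cell $\theta\colon\mathbb{T}X\to X$ with $\theta\circ\iota_X=\mathrm{id}_X$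 and an invertible $2$-cell $\varphi\colon\theta\circ\mathbb{T}\theta\Rightarrow\theta\circ\mu_X$ such that $\varphi\circ\iota_{\mathbb{T}X}$ and $\varphi\circ\mathbb{T}\iota_X$ are identities and the following two $2$-cells $\theta\circ\mathbb{T}\theta\circ\mathbb{T}^2\theta\Rightarrow\theta\circ\mu_X\circ\mu_{\mathbb{T}X}$ agree: ($\varphi\circ\mathbb{T}^2\theta$ followed by $\varphi\circ\mu_{\mathbb{T}X}$), and ($\theta\circ\mathbb{T}\varphi$ followed by $\varphi\circ\mathbb{T}\mu_X$). A $\mathbb{T}$-pseudomorphism $(f,\zeta)\colon(X,\theta,\varphi)\to(Y,\xi,\psi)$ is a $1$-cell $f\colon X\to Y$ and an invertible $2$-cell $\zeta\colon\xi\circ\mathbb{T}f\Rightarrow f\circ\theta$ such that $\zeta\circ\iota_X$ is the identity of $f$ and the following two $2$-cells $\xi\circ\mathbb{T}\xi\circ\mathbb{T}^2f\Rightarrow f\circ\theta\circ\mu_X$ agree: ($\xi\circ\mathbb{T}\zeta$, then $\zeta\circ\mathbb{T}\theta$, then $f\circ\varphi$), and ($\psi\circ\mathbb{T}^2f$, then $\zeta\circ\mu_X$). It is a strict $\mathbb{T}$-map if $\zeta$ is the identity. An algebra $2$-cell $\lambda\colon(f,\zeta)\Rightarrow(g,\kappa)$ is a $2$-cell $\lambda\colon f\Rightarrow g$ in $\mathcal{K}$, not necessarily invertible, such that $\xi\circ\mathbb{T}\lambda$ followed by $\kappa$ equals $\zeta$ followed by $\lambda\circ\theta$. $\mathbb{T}\text{-}\mathbf{PsAlg}$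 is the $2$-category of $\mathbb{T}$-pseudoalgebras, $\mathbb{T}$-pseudomorphisms and algebra $2$-cells; $\mathbb{T}\text{-}\mathbf{AlgSt}$ is the $2$-category of strict $\mathbb{T}$-algebras, strict $\mathbb{T}$-maps and algebra $2$-cells. **Internal equivalence.** An internal equivalence between $0$-cells $X,Y$ of a $2$-category consists of $1$-cells $f\colon X\to Y$, $g\colon Y\to X$ and invertible $2$-cells $\mathrm{id}\Rightarrow g\circ f$ and $f\circ g\Rightarrow\mathrm{id}$. *)

(* Defs.v *)
From mathcomp Require Import ssreflect.
From Stdlib Require Import ProofIrrelevance.

Set Implicit Arguments.
Unset Strict Implicit.
Unset Printing Implicit Defensive.

Declare Scope twocat_scope.
Delimit Scope twocat_scope with twocat.
Local Open Scope twocat_scope.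

(** In a 2-category, 1-cells such as [(h ∘ g) ∘ f] and [h ∘ (g ∘ f)] are equal
    but not convertible, so equal 2-cells may live in different types.
    [α ≡ β] says that the boundaries of [α] and [β] are equal 1-cells and that
    [α] and [β] are equal modulo these identifications. *)
Inductive same_cell {H : Type} {C : H -> H -> Type} {f g : H} (α : C f g) :
  forall {f' g' : H}, C f' g' -> Prop :=
| same_cell_refl : same_cell α α.

Notation "α ≡ β" := (same_cell α β) (at level 70, no associativity)
  : twocat_scope.

(** Strict 2-categories. [comp1 g f] and [hcomp β α] are written in
    applicative order, [vcomp α β] in diagrammatic order. *)
Record TwoCat := {
  ob :> Type;
  hom : ob -> ob -> Type;
  cell : forall X Y, hom X Y -> hom X Y -> Type;
  id1 : forall X, hom X X;
  comp1 : forall X Y Z, hom Y Z -> hom X Y -> hom X Z;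
  id2 : forall X Y (f : hom X Y), cell f f;
  vcomp : forall X Y (f g h : hom X Y), cell f g -> cell g h -> cell f h;
  hcomp : forall X Y Z (g g' : hom Y Z) (f f' : hom X Y),
    cell g g' -> cell f f' -> cell (comp1 g f) (comp1 g' f');
  id1_l : forall X Y (f : hom X Y), comp1 (id1 Y) f = f;
  id1_r : forall X Y (f : hom X Y), comp1 f (id1 X) = f;
  comp1A : forall X Y Z W (h : hom Z W) (g : hom Y Z) (f : hom X Y),
    comp1 h (comp1 g f) = comp1 (comp1 h g) f;
  vcomp_id_l : forall X Y (f g : hom X Y) (α : cell f g), vcomp (id2 f) α = α;
  vcomp_id_r : forall X Y (f g : hom X Y) (α : cell f g), vcomp α (id2 g) = α;
  vcompA : forall X Y (f g h k : hom X Y)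
      (α : cell f g) (β : cell g h) (γ : cell h k),
    vcomp α (vcomp β γ) = vcomp (vcomp α β) γ;
  hcomp_id2 : forall X Y Z (g : hom Y Z) (f : hom X Y),
    hcomp (id2 g) (id2 f) = id2 (comp1 g f);
  interchange : forall X Y Z (g g' g'' : hom Y Z) (f f' f'' : hom X Y)
      (β : cell g g') (β' : cell g' g'') (α : cell f f') (α' : cell f' f''),
    hcomp (vcomp β β') (vcomp α α') = vcomp (hcomp β α) (hcomp β' α');
  hcomp_id_l : forall X Y (f g : hom X Y) (α : cell f g),
    hcomp (id2 (id1 Y)) α ≡ α;
  hcomp_id_r : forall X Y (f g : hom X Y) (α : cell f g),
    hcomp α (id2 (id1 X)) ≡ α;
  hcompA : forall X Y Z W (h h' : hom Z W) (g g' : hom Y Z) (f f' : hom X Y)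
      (γ : cell h h') (β : cell g g') (α : cell f f'),
    hcomp γ (hcomp β α) ≡ hcomp (hcomp γ β) α
}.

Arguments hom {_} _ _.
Arguments cell {_ _ _} _ _.
Arguments id1 {_} _.
Arguments comp1 {_ _ _ _} _ _.
Arguments id2 {_ _ _} _.
Arguments vcomp {_ _ _ _ _ _} _ _.
Arguments hcomp {_ _ _ _ _ _ _ _} _ _.

Notation "g ∘ f" := (comp1 g f) (at level 40, left associativity)
  : twocat_scope.
Notation "β ∗ α" := (hcomp β α) (at level 40, left associativity)
  : twocat_scope.
Notation "g ◃ α" := (hcomp (id2 g) α) (at level 40, left associativity)
  : twocat_scope.
Notation "α ▹ f" := (hcomp α (id2 f)) (at level 40, left associativity)
  : twocat_scope.

Section TwoCatTheory.
Variable K : TwoCat.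

Definition eqcell (X Y : K) (f g : hom X Y) (e : f = g) : cell f g :=
  match e in _ = g' return cell f g' with eq_refl => id2 f end.

(** Vertical composite [α] then [β], when the target of [α] and the source of
    [β] are only propositionally equal. *)
Definition vcomp_along (X Y : K) (f g g' h : hom X Y)
    (α : cell f g) (β : cell g' h) (e : g = g') : cell f h :=
  vcomp α (vcomp (eqcell e) β).

Definition is_identity (X Y : K) (f g : hom X Y) (α : cell f g) : Prop :=
  α ≡ id2 f.

Definition invertible (X Y : K) (f g : hom X Y) (α : cell f g) : Prop :=
  exists β : cell g f, vcomp α β = id2 f /\ vcomp β α = id2 g.

Definition isomorphic (X Y : K) (f g : hom X Y) : Prop :=
  exists α : cell f g, invertible α.

Definition is_iso (X Y : K) (f : hom X Y) : Prop :=
  exists g : hom Y X, g ∘ f = id1 X /\ f ∘ g = id1 Y.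

Definition is_internal_equivalence (X Y : K) (f : hom X Y) : Prop :=
  exists (g : hom Y X) (α : cell (id1 X) (g ∘ f)) (β : cell (f ∘ g) (id1 Y)),
    invertible α /\ invertible β.

End TwoCatTheory.

Record TwoFunctor (C D : TwoCat) := {
  fob :> C -> D;
  fmap : forall X Y : C, hom X Y -> hom (fob X) (fob Y);
  fmap2 : forall (X Y : C) (f g : hom X Y),
    cell f g -> cell (fmap f) (fmap g);
  fmap_id : forall X : C, fmap (id1 X) = id1 (fob X);
  fmap_comp : forall (X Y Z : C) (g : hom Y Z) (f : hom X Y),
    fmap (g ∘ f) = fmap g ∘ fmap f;
  fmap2_id : forall (X Y : C) (f : hom X Y), fmap2 (id2 f) = id2 (fmap f);
  fmap2_vcomp : forall (X Y : C) (f g h : hom X Y)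
      (α : cell f g) (β : cell g h),
    fmap2 (vcomp α β) = vcomp (fmap2 α) (fmap2 β);
  fmap2_hcomp : forall (X Y Z : C) (g g' : hom Y Z) (f f' : hom X Y)
      (β : cell g g') (α : cell f f'),
    fmap2 (β ∗ α) ≡ fmap2 β ∗ fmap2 α
}.

Arguments fmap {_ _} _ {_ _} _.
Arguments fmap2 {_ _} _ {_ _ _ _} _.

Section SameCell.
Variable K : TwoCat.
Implicit Types X Y Z : K.

Lemma same_sym X Y (f g f' g' : hom X Y) (α : cell f g) (α' : cell f' g') :
  α ≡ α' -> α' ≡ α.
Proof. by case. Qed.

Lemma same_trans X Y (f g f' g' f'' g'' : hom X Y) (α : cell f g)
    (α' : cell f' g') (α'' : cell f'' g'') : α ≡ α' -> α' ≡ α'' -> α ≡ α''.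
Proof. by case. Qed.

Lemma same_inv X Y (f g f' g' : hom X Y) (α : cell f g) (α' : cell f' g') :
  α ≡ α' -> exists (ef : f = f') (eg : g = g'),
    eq_rect g (cell f') (eq_rect f (fun x => cell x g) α f' ef) g' eg = α'.
Proof. by case; exists eq_refl, eq_refl. Qed.

Lemma same_eq X Y (f g : hom X Y) (α β : cell f g) : α ≡ β -> α = β.
Proof.
move=> /same_inv [ef [eg <-]].
by rewrite (proof_irrelevance _ ef eq_refl) (proof_irrelevance _ eg eq_refl).
Qed.

Lemma eq_same X Y (f g : hom X Y) (α β : cell f g) : α = β -> α ≡ β.
Proof. by move=> ->. Qed.

Lemma eqcell_same X Y (f g : hom X Y) (e : f = g) : eqcell e ≡ id2 f.
Proof. by case: g / e. Qed.

Lemma id2_same X Y (f g : hom X Y) : f = g -> id2 f ≡ id2 g.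
Proof. by move=> ->. Qed.

Lemma eqcell_same2 X Y (f g f' g' : hom X Y) (e : f = g) (e' : f' = g') :
  f = f' -> eqcell e ≡ eqcell e'.
Proof.
move=> E; apply: same_trans (eqcell_same e) _.
by apply: same_trans (id2_same E) _; apply: same_sym (eqcell_same e').
Qed.

Lemma eqcell_invertible X Y (f g : hom X Y) (e : f = g) : invertible (eqcell e).
Proof. by case: g / e; exists (id2 f); rewrite vcomp_id_l. Qed.

Lemma vcomp_same X Y (f g h f' g' h' : hom X Y) (α : cell f g) (β : cell g h)
    (α' : cell f' g') (β' : cell g' h') :
  α ≡ α' -> β ≡ β' -> vcomp α β ≡ vcomp α' β'.
Proof.
move=> /same_inv [ef [eg E]]; subst.
move=> /same_inv [eg [eh E]]; subst.
by rewrite (proof_irrelevance _ eg eq_refl).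
Qed.

Lemma hcomp_same X Y Z (g k g' k' : hom Y Z) (f h f' h' : hom X Y)
    (β : cell g k) (α : cell f h) (β' : cell g' k') (α' : cell f' h') :
  β ≡ β' -> α ≡ α' -> β ∗ α ≡ β' ∗ α'.
Proof. by case; case. Qed.

Lemma fmap2_same L (F : TwoFunctor K L) X Y (f g f' g' : hom X Y)
    (α : cell f g) (α' : cell f' g') :
  α ≡ α' -> fmap2 F α ≡ fmap2 F α'.
Proof. by case. Qed.

Lemma along_same X Y (f g k h f' g' k' h' : hom X Y) (e : g = k) (e' : g' = k')
    (α : cell f g) (β : cell k h) (α' : cell f' g') (β' : cell k' h') :
  α ≡ α' -> β ≡ β' -> vcomp_along α β e ≡ vcomp_along α' β' e'.
Proof.
move: β β'; case: k / e => β; case: k' / e' => β' Ha Hb.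
by rewrite /vcomp_along /= !vcomp_id_l; apply: vcomp_same.
Qed.

Lemma along_same1 X Y (f g k h f' g' k' h' : hom X Y) (e : g = k)
    (α : cell f g) (β : cell k h) (α' : cell f' g') (β' : cell k' h') :
  α ≡ α' -> β ≡ β' ->
  exists e' : g' = k', vcomp_along α β e ≡ vcomp_along α' β' e'.
Proof.
move=> Ha Hb; have /same_inv [_ [E _]] := Ha; have /same_inv [E' _] := Hb.
have e' : g' = k' by rewrite -E -E'.
by exists e'; apply: along_same.
Qed.

Lemma along_trans_l X Y (f g k h f' g' x y : hom X Y) (e : g = k)
    (α : cell f g) (β : cell k h) (α' : cell f' g') (γ : cell x y) :
  α ≡ α' -> (forall e', vcomp_along α' β e' ≡ γ) -> vcomp_along α β e ≡ γ.
Proof.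
move=> Ha Hg; have [e' H] := along_same1 e Ha (same_cell_refl β).
exact: same_trans H (Hg e').
Qed.

Lemma along_trans_r X Y (f g k h k' h' x y : hom X Y) (e : g = k)
    (α : cell f g) (β : cell k h) (β' : cell k' h') (γ : cell x y) :
  β ≡ β' -> (forall e', vcomp_along α β' e' ≡ γ) -> vcomp_along α β e ≡ γ.
Proof.
move=> Hb Hg; have [e' H] := along_same1 e (same_cell_refl α) Hb.
exact: same_trans H (Hg e').
Qed.

Lemma along_trans_ll X Y (f g k l m h f' g' k' l' x y : hom X Y)
    (e : g = k) (e1 : l = m) (α : cell f g) (β : cell k l) (γ : cell m h)
    (α' : cell f' g') (β' : cell k' l') (δ : cell x y) :
  α ≡ α' -> β ≡ β' ->
  (forall e' e1', vcomp_along (vcomp_along α' β' e') γ e1' ≡ δ) ->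
  vcomp_along (vcomp_along α β e) γ e1 ≡ δ.
Proof.
move=> Ha Hb H; have [e' H'] := along_same1 e Ha Hb.
by apply: along_trans_l H' _.
Qed.

Lemma along_trans_rr X Y (f g k l m h m' h' k' l' x y : hom X Y)
    (e : g = k) (e1 : l = m) (α : cell f g) (β : cell k l) (γ : cell m h)
    (β' : cell k' l') (γ' : cell m' h') (δ : cell x y) :
  β ≡ β' -> γ ≡ γ' ->
  (forall e' e1', vcomp_along α (vcomp_along β' γ' e1') e' ≡ δ) ->
  vcomp_along α (vcomp_along β γ e1) e ≡ δ.
Proof.
move=> Hb Hc H; have [e' H'] := along_same1 e1 Hb Hc.
by apply: along_trans_r H' _.
Qed.

Lemma along_vcomp X Y (f g h : hom X Y) (e : g = g) (α : cell f g)
    (β : cell g h) : vcomp_along α β e = vcomp α β.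
Proof.
by rewrite (proof_irrelevance _ e eq_refl) /vcomp_along vcomp_id_l.
Qed.

Lemma alongA X Y (f g g' h h' k : hom X Y) (e : g = g') (e' : h = h')
    (α : cell f g) (β : cell g' h) (γ : cell h' k) :
  vcomp_along (vcomp_along α β e) γ e' = vcomp_along α (vcomp_along β γ e') e.
Proof. by rewrite /vcomp_along !vcompA. Qed.

Lemma along_id_l X Y (f f0 g h k : hom X Y) (e : f0 = g) (ι : cell f f0)
    (α : cell g h) : ι ≡ id2 k -> vcomp_along ι α e ≡ α.
Proof.
move: α; case: g / e => α H; have /same_inv [_ [E _]] := H; subst k.
rewrite along_vcomp; apply: same_trans (vcomp_same H (same_cell_refl α)) _.
by rewrite vcomp_id_l.
Qed.

Lemma along_id_r X Y (f g h h0 k : hom X Y) (e : g = h) (ι : cell h h0)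
    (α : cell f g) : ι ≡ id2 k -> vcomp_along α ι e ≡ α.
Proof.
move: ι; case: h / e => ι H; have /same_inv [E _] := H; subst k.
rewrite along_vcomp; apply: same_trans (vcomp_same (same_cell_refl α) H) _.
by rewrite vcomp_id_r.
Qed.

Lemma hcomp_along X Y Z (g g1 g1' g2 : hom Y Z) (f f1 f1' f2 : hom X Y)
    (e : g1 = g1') (e' : f1 = f1') (e'' : g1 ∘ f1 = g1' ∘ f1')
    (β : cell g g1) (β' : cell g1' g2) (α : cell f f1) (α' : cell f1' f2) :
  vcomp_along β β' e ∗ vcomp_along α α' e' =
  vcomp_along (β ∗ α) (β' ∗ α') e''.
Proof.
move: e'' β' α'; case: g1' / e; case: f1' / e' => e'' β' α'.
by rewrite !along_vcomp interchange.
Qed.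

Lemma whisker_l_along X Y Z (g : hom Y Z) (f f1 f1' f2 : hom X Y)
    (e : f1 = f1') (α : cell f f1) (α' : cell f1' f2) :
  g ◃ vcomp_along α α' e =
  vcomp_along (g ◃ α) (g ◃ α') (f_equal (comp1 g) e).
Proof.
by rewrite -(hcomp_along eq_refl e) along_vcomp vcomp_id_l.
Qed.

Lemma whisker_r_along X Y Z (g g1 g1' g2 : hom Y Z) (f : hom X Y)
    (e : g1 = g1') (β : cell g g1) (β' : cell g1' g2) :
  vcomp_along β β' e ▹ f =
  vcomp_along (β ▹ f) (β' ▹ f) (f_equal (fun x => x ∘ f) e).
Proof.
by rewrite -(hcomp_along e eq_refl) along_vcomp vcomp_id_l.
Qed.

Lemma whisker_l_vcomp X Y Z (g : hom Y Z) (f f1 f2 : hom X Y)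
    (α : cell f f1) (α' : cell f1 f2) :
  g ◃ vcomp α α' = vcomp (g ◃ α) (g ◃ α').
Proof. by rewrite -interchange vcomp_id_l. Qed.

Lemma whisker_r_vcomp X Y Z (g g1 g2 : hom Y Z) (f : hom X Y)
    (β : cell g g1) (β' : cell g1 g2) :
  vcomp β β' ▹ f = vcomp (β ▹ f) (β' ▹ f).
Proof. by rewrite -interchange vcomp_id_l. Qed.

Lemma whisker_l_same X Y Z (g g' : hom Y Z) (f h f' h' : hom X Y)
    (α : cell f h) (α' : cell f' h') : g = g' -> α ≡ α' -> g ◃ α ≡ g' ◃ α'.
Proof. by move=> -> H; apply: hcomp_same. Qed.

Lemma whisker_r_same X Y Z (g h g' h' : hom Y Z) (f f' : hom X Y)
    (α : cell g h) (α' : cell g' h') : f = f' -> α ≡ α' -> α ▹ f ≡ α' ▹ f'.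
Proof. by move=> -> H; apply: hcomp_same. Qed.

Lemma along_swap X Y Z (g g' : hom Y Z) (f f' : hom X Y)
    (h1 h2 h3 h4 : hom X Z) (e : h2 = h3)
    (b : cell h1 h2) (a : cell h3 h4) (β : cell g g') (α : cell f f') :
  b ≡ g ◃ α -> a ≡ β ▹ f' ->
  vcomp_along b a e ≡ vcomp_along (β ▹ f) (g' ◃ α) eq_refl.
Proof.
move=> Hb Ha; have [e' H] := along_same1 e Hb Ha; apply: same_trans H _.
by rewrite !along_vcomp -!interchange !vcomp_id_l !vcomp_id_r.
Qed.

Lemma whisker_lA X Y Z W (h : hom Z W) (g : hom Y Z) (f f' : hom X Y)
    (α : cell f f') : h ◃ (g ◃ α) ≡ (h ∘ g) ◃ α.
Proof. by rewrite -hcomp_id2; apply: hcompA. Qed.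

Lemma whisker_rA X Y Z W (h h' : hom Z W) (g : hom Y Z) (f : hom X Y)
    (α : cell h h') : α ▹ (g ∘ f) ≡ α ▹ g ▹ f.
Proof. by rewrite -hcomp_id2; apply: hcompA. Qed.

Lemma whisker_lr X Y Z W (h : hom Z W) (g g' : hom Y Z) (f : hom X Y)
    (α : cell g g') : h ◃ (α ▹ f) ≡ h ◃ α ▹ f.
Proof. exact: hcompA. Qed.

Lemma whisker_id_l X Y Z (g : hom Y Z) (f f' h : hom X Y) (α : cell f f') :
  α ≡ id2 h -> g ◃ α ≡ id2 (g ∘ h).
Proof.
move=> H; apply: same_trans (whisker_l_same eq_refl H) _.
by rewrite hcomp_id2.
Qed.

Lemma whisker_id_r X Y Z (g g' h : hom Y Z) (f : hom X Y) (α : cell g g') :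
  α ≡ id2 h -> α ▹ f ≡ id2 (h ∘ f).
Proof.
move=> H; apply: same_trans (whisker_r_same eq_refl H) _.
by rewrite hcomp_id2.
Qed.

Lemma is_identity_same X Y (f g h : hom X Y) (α : cell f g) :
  α ≡ id2 h -> is_identity α.
Proof.
move=> H; rewrite /is_identity; have /same_inv [e _] := H.
by apply: same_trans H (id2_same (eq_sym e)).
Qed.

Definition recast X Y (f f' g g' : hom X Y) (α : cell f g)
    (e : f' = f) (e' : g = g') : cell f' g' :=
  vcomp (eqcell e) (vcomp α (eqcell e')).

Lemma recast_same X Y (f f' g g' : hom X Y) (α : cell f g)
    (e : f' = f) (e' : g = g') : recast α e e' ≡ α.
Proof.
move: α; case: f / e => α; case: g' / e'.
by rewrite /recast vcomp_id_l vcomp_id_r.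
Qed.

Lemma vcomp_invertible X Y (f g h : hom X Y) (α : cell f g) (β : cell g h) :
  invertible α -> invertible β -> invertible (vcomp α β).
Proof.
move=> [α' [Ha Ha']] [β' [Hb Hb']]; exists (vcomp β' α'); split.
- by rewrite -vcompA (vcompA β) Hb vcomp_id_l.
- by rewrite -vcompA (vcompA α') Ha' vcomp_id_l.
Qed.

Lemma whisker_l_invertible X Y Z (g : hom Y Z) (f f' : hom X Y)
    (α : cell f f') : invertible α -> invertible (g ◃ α).
Proof.
move=> [β [H H']]; exists (g ◃ β).
by rewrite -!whisker_l_vcomp H H' !hcomp_id2.
Qed.

Lemma whisker_r_invertible X Y Z (g g' : hom Y Z) (f : hom X Y)
    (α : cell g g') : invertible α -> invertible (α ▹ f).
Proof.
move=> [β [H H']]; exists (β ▹ f).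
by rewrite -!whisker_r_vcomp H H' !hcomp_id2.
Qed.

Lemma along_invertible X Y (f g g' h : hom X Y) (α : cell f g)
    (β : cell g' h) (e : g = g') :
  invertible α -> invertible β -> invertible (vcomp_along α β e).
Proof.
move=> Ha Hb; apply: vcomp_invertible => //.
by apply: vcomp_invertible => //; apply: eqcell_invertible.
Qed.

Lemma recast_invertible X Y (f f' g g' : hom X Y) (α : cell f g)
    (e : f' = f) (e' : g = g') : invertible α -> invertible (recast α e e').
Proof.
move=> H; apply: vcomp_invertible; first exact: eqcell_invertible.
by apply: vcomp_invertible => //; apply: eqcell_invertible.
Qed.

End SameCell.

Lemma fmap2_along (K L : TwoCat) (F : TwoFunctor K L) (X Y : K)
    (f g g' h : hom X Y) (e : g = g') (α : cell f g) (β : cell g' h) :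
  fmap2 F (vcomp_along α β e) =
  vcomp_along (fmap2 F α) (fmap2 F β) (f_equal (fmap F (Y:=Y)) e).
Proof. by move: β; case: g' / e => β; rewrite !along_vcomp fmap2_vcomp. Qed.

Lemma fmap2_whisker_l (K L : TwoCat) (F : TwoFunctor K L) (X Y Z : K)
    (g : hom Y Z) (f f' : hom X Y) (α : cell f f') :
  fmap2 F (g ◃ α) ≡ fmap F g ◃ fmap2 F α.
Proof. by rewrite -fmap2_id; apply: fmap2_hcomp. Qed.

Lemma fmap2_whisker_r (K L : TwoCat) (F : TwoFunctor K L) (X Y Z : K)
    (g g' : hom Y Z) (f : hom X Y) (α : cell g g') :
  fmap2 F (α ▹ f) ≡ fmap2 F α ▹ fmap F f.
Proof. by rewrite -fmap2_id; apply: fmap2_hcomp. Qed.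

Lemma fmap2_is_id (K L : TwoCat) (F : TwoFunctor K L) (X Y : K)
    (f f' h : hom X Y) (α : cell f f') :
  α ≡ id2 h -> fmap2 F α ≡ id2 (fmap F h).
Proof. by rewrite -fmap2_id; apply: fmap2_same. Qed.

Lemma fid_hcomp (C : TwoCat) (X Y Z : C) (g g' : hom Y Z) (f f' : hom X Y)
    (β : cell g g') (α : cell f f') : β ∗ α ≡ β ∗ α.
Proof. by []. Qed.

Definition fidentity (C : TwoCat) : TwoFunctor C C :=
  @Build_TwoFunctor C C (fun X => X) (fun X Y f => f) (fun X Y f g α => α)
    (fun X => eq_refl) (fun X Y Z g f => eq_refl) (fun X Y f => eq_refl)
    (fun X Y f g h α β => eq_refl) (@fid_hcomp C).

Section Composite.
Variables (C D E : TwoCat) (G : TwoFunctor D E) (F : TwoFunctor C D).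

Lemma fc_id (X : C) : fmap G (fmap F (id1 X)) = id1 (G (F X)).
Proof. by rewrite !fmap_id. Qed.

Lemma fc_comp (X Y Z : C) (g : hom Y Z) (f : hom X Y) :
  fmap G (fmap F (g ∘ f)) = fmap G (fmap F g) ∘ fmap G (fmap F f).
Proof. by rewrite !fmap_comp. Qed.

Lemma fc_id2 (X Y : C) (f : hom X Y) :
  fmap2 G (fmap2 F (id2 f)) = id2 (fmap G (fmap F f)).
Proof. by rewrite !fmap2_id. Qed.

Lemma fc_vcomp (X Y : C) (f g h : hom X Y) (α : cell f g) (β : cell g h) :
  fmap2 G (fmap2 F (vcomp α β)) =
  vcomp (fmap2 G (fmap2 F α)) (fmap2 G (fmap2 F β)).
Proof. by rewrite !fmap2_vcomp. Qed.

Lemma fc_hcomp (X Y Z : C) (g g' : hom Y Z) (f f' : hom X Y)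
    (β : cell g g') (α : cell f f') :
  fmap2 G (fmap2 F (β ∗ α)) ≡ fmap2 G (fmap2 F β) ∗ fmap2 G (fmap2 F α).
Proof.
apply: same_trans (fmap2_hcomp G _ _).
by apply: fmap2_same; apply: fmap2_hcomp.
Qed.

Definition fcompose : TwoFunctor C E :=
  @Build_TwoFunctor C E (fun X => G (F X)) (fun X Y f => fmap G (fmap F f))
    (fun X Y f g α => fmap2 G (fmap2 F α)) fc_id fc_comp fc_id2 fc_vcomp
    fc_hcomp.
End Composite.

Record TwoNat (C D : TwoCat) (F G : TwoFunctor C D) := {
  component :> forall X : C, hom (F X) (G X);
  naturality : forall (X Y : C) (f : hom X Y),
    component Y ∘ fmap F f = fmap G f ∘ component X;
  naturality2 : forall (X Y : C) (f g : hom X Y) (α : cell f g),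
    component Y ◃ fmap2 F α ≡ fmap2 G α ▹ component X
}.

(** 2-adjunctions, presented by unit and counit. *)
Record TwoAdjunction (C D : TwoCat) (L : TwoFunctor C D) (R : TwoFunctor D C)
    := {
  adj_unit : TwoNat (fidentity C) (fcompose R L);
  adj_counit : TwoNat (fcompose L R) (fidentity D);
  triangle_l : forall X : C,
    adj_counit (L X) ∘ fmap L (adj_unit X) = id1 (L X);
  triangle_r : forall Y : D,
    fmap R (adj_counit Y) ∘ adj_unit (R Y) = id1 (R Y)
}.

Record TwoMonad (K : TwoCat) := {
  tfun :> TwoFunctor K K;
  mι : TwoNat (fidentity K) tfun;
  mμ : TwoNat (fcompose tfun tfun) tfun;
  monad_unit_l : forall X : K, mμ X ∘ mι (tfun X) = id1 (tfun X);
  monad_unit_r : forall X : K, mμ X ∘ fmap tfun (mι X) = id1 (tfun X);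
  monad_assoc : forall X : K,
    mμ X ∘ mμ (tfun X) = mμ X ∘ fmap tfun (mμ X)
}.

Definition cell1_class (K : TwoCat) := forall X Y : K, hom X Y -> Prop.

(** [(w, φ')] is a diagonal filler of the square [φ : u ∘ e ⇒ m ∘ v]. *)
Definition is_filler (K : TwoCat) (A X B Y : K) (e : hom A X) (m : hom B Y)
    (v : hom A B) (u : hom X Y) (φ : cell (u ∘ e) (m ∘ v))
    (w : hom X B) (φ' : cell u (m ∘ w)) : Prop :=
  invertible φ' /\ w ∘ e = v /\ φ' ▹ e ≡ φ.

Record is_EFS (K : TwoCat) (E M : cell1_class K) : Prop := {
  E_iso : forall (X Y : K) (f : hom X Y), is_iso f -> E X Y f;
  M_iso : forall (X Y : K) (f : hom X Y), is_iso f -> M X Y f;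
  EFS_factor : forall (X Y : K) (f : hom X Y),
    exists (I : K) (e : hom X I) (m : hom I Y), E X I e /\ M I Y m /\ m ∘ e = f;
  EFS_fill : forall (A X B Y : K) (e : hom A X) (m : hom B Y)
      (v : hom A B) (u : hom X Y) (φ : cell (u ∘ e) (m ∘ v)),
    E A X e -> M B Y m -> invertible φ ->
    exists (w : hom X B) (φ' : cell u (m ∘ w)),
      is_filler φ φ' /\
      (forall (w1 : hom X B) (φ1 : cell u (m ∘ w1)),
        is_filler φ φ1 -> w1 = w /\ φ1 ≡ φ') /\
      (is_identity φ -> u = m ∘ w /\ is_identity φ');
  EFS_fill2 : forall (A X B Y : K) (e : hom A X) (m : hom B Y)
      (v v' : hom A B) (u u' : hom X Y)
      (h : u ∘ e = m ∘ v) (h' : u' ∘ e = m ∘ v')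
      (σ : cell v v') (τ : cell u u')
      (w w' : hom X B) (φ : cell u (m ∘ w)) (φ' : cell u' (m ∘ w')),
    E A X e -> M B Y m -> τ ▹ e ≡ m ◃ σ ->
    is_filler (eqcell h) φ -> is_filler (eqcell h') φ' ->
    exists! ρ : cell w w', ρ ▹ e ≡ σ /\ m ◃ ρ ≡ τ
}.

Record is_rigid_EFS (K : TwoCat) (E M : cell1_class K) : Prop := {
  rigid_EFS :> is_EFS E M;
  EFS_rigid : forall (X Y : K) (m : hom Y X) (f : hom X Y),
    M Y X m -> isomorphic (m ∘ f) (id1 X) -> isomorphic (f ∘ m) (id1 Y)
}.

Definition preserves_class (K : TwoCat) (F : TwoFunctor K K)
    (E : cell1_class K) : Prop :=
  forall (X Y : K) (e : hom X Y), E X Y e -> E (F X) (F Y) (fmap F e).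

Lemma nat_ι (K : TwoCat) (T : TwoMonad K) (X Y : K) (f : hom X Y) :
  fmap T f ∘ mι T X = mι T Y ∘ f.
Proof. by rewrite -(naturality (mι T)). Qed.

Lemma nat_μ (K : TwoCat) (T : TwoMonad K) (X Y : K) (f : hom X Y) :
  mμ T Y ∘ fmap T (fmap T f) = fmap T f ∘ mμ T X.
Proof. exact: (naturality (mμ T)). Qed.

Lemma comp1A' (K : TwoCat) (X Y Z W : K) (h : hom Z W) (g : hom Y Z)
    (f : hom X Y) : (h ∘ g) ∘ f = h ∘ (g ∘ f).
Proof. by rewrite comp1A. Qed.

Lemma act_comp (K : TwoCat) (T : TwoMonad K) (X Y Z W : K) (ξ : hom (T Z) W)
    (g : hom Y Z) (f : hom X Y) :
  ξ ∘ fmap T (g ∘ f) = (ξ ∘ fmap T g) ∘ fmap T f.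
Proof. by rewrite fmap_comp comp1A. Qed.

Lemma act_nat_μ (K : TwoCat) (T : TwoMonad K) (X Y Z : K) (ξ : hom (T Y) Z)
    (f : hom X Y) :
  (ξ ∘ mμ T Y) ∘ fmap T (fmap T f) = (ξ ∘ fmap T f) ∘ mμ T X.
Proof. by rewrite -!comp1A nat_μ. Qed.

Notation "α ⨾[ e ] β" := (vcomp_along α β e)
  (at level 50, left associativity) : twocat_scope.

Section Algebras.
Variables (K : TwoCat) (T : TwoMonad K).
Local Notation ι := (mι T).
Local Notation μ := (mμ T).
Local Notation T1 f := (fmap T f).
Local Notation T2 α := (fmap2 T α).

(** The equations below paste 2-cells along equalities of 1-cells:
    [α ⨾[e] β] is [α] followed by [β], with [e] identifying the target of [α]
    with the source of [β]. *)
Record PsAlgebra := {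
  pcar :> K;
  pact : hom (T pcar) pcar;
  passoc : cell (pact ∘ T1 pact) (pact ∘ μ pcar);
  pact_unit : pact ∘ ι pcar = id1 pcar;
  passoc_inv : invertible passoc;
  passoc_unit_l : is_identity (passoc ▹ ι (T pcar));
  passoc_unit_r : is_identity (passoc ▹ T1 (ι pcar));
  passoc_coh :
    (passoc ▹ T1 (T1 pact))
      ⨾[act_nat_μ pact pact] (passoc ▹ μ (T pcar)) ≡
    (pact ◃ T2 passoc)
      ⨾[act_comp pact pact (μ pcar)] (passoc ▹ T1 (μ pcar))
}.

Record PsHom (X Y : PsAlgebra) := {
  phom : hom X Y;
  pcell : cell (pact Y ∘ T1 phom) (phom ∘ pact X);
  pcell_inv : invertible pcell;
  pcell_unit : pcell ▹ ι X ≡ id2 phom;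
  pcell_coh :
    (pact Y ◃ T2 pcell)
      ⨾[act_comp (pact Y) phom (pact X)] (pcell ▹ T1 (pact X))
      ⨾[comp1A' phom (pact X) (T1 (pact X))] (phom ◃ passoc X) ≡
    (passoc Y ▹ T1 (T1 phom))
      ⨾[act_nat_μ (pact Y) phom] (pcell ▹ μ X)
}.

Lemma PsHom_eq (X Y : PsAlgebra) (p q : PsHom X Y) :
  phom p = phom q -> pcell p ≡ pcell q -> p = q.
Proof.
case: p => f ζ i u c; case: q => f' ζ' i' u' c' /= E.
subst f' => /same_eq E; subst ζ'.
by rewrite (proof_irrelevance _ i i') (proof_irrelevance _ u u')
  (proof_irrelevance _ c c').
Qed.

Section Identity.
Variable X : PsAlgebra.

Lemma ps_id_eq : pact X ∘ T1 (id1 X) = id1 X ∘ pact X.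
Proof. by rewrite fmap_id id1_l id1_r. Qed.

Lemma ps_id_unit : eqcell ps_id_eq ▹ ι X ≡ id2 (id1 X).
Proof.
apply: same_trans (whisker_id_r _ (eqcell_same _)) _.
by apply: id2_same; rewrite fmap_id id1_r pact_unit.
Qed.

Lemma ps_id_coh :
  (pact X ◃ T2 (eqcell ps_id_eq))
    ⨾[act_comp (pact X) (id1 X) (pact X)] (eqcell ps_id_eq ▹ T1 (pact X))
    ⨾[comp1A' (id1 X) (pact X) (T1 (pact X))] (id1 X ◃ passoc X) ≡
  (passoc X ▹ T1 (T1 (id1 X)))
    ⨾[act_nat_μ (pact X) (id1 X)] (eqcell ps_id_eq ▹ μ X).
Proof.
rewrite alongA.
apply: same_trans (along_id_l _ _ _) _.
  by apply: whisker_id_l; apply: fmap2_is_id; apply: eqcell_same.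
apply: same_trans (along_id_l _ _ _) _.
  by apply: whisker_id_r; apply: eqcell_same.
apply: same_trans (hcomp_id_l _) (same_sym _).
apply: same_trans (along_id_r _ _ _) _.
  by apply: whisker_id_r; apply: eqcell_same.
by rewrite !fmap_id; apply: hcomp_id_r.
Qed.

Definition ps_id : PsHom X X :=
  @Build_PsHom X X (id1 X) (eqcell ps_id_eq) (eqcell_invertible _)
    ps_id_unit ps_id_coh.
End Identity.

Section Composition.
Variables (X Y Z : PsAlgebra) (q : PsHom Y Z) (p : PsHom X Y).
Local Notation f := (phom p).
Local Notation g := (phom q).

Definition ps_comp_cell : cell (pact Z ∘ T1 (g ∘ f)) ((g ∘ f) ∘ pact X) :=
  recast ((pcell q ▹ T1 f) ⨾[comp1A' g (pact Y) (T1 f)] (g ◃ pcell p))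
    (act_comp (pact Z) g f) (comp1A g f (pact X)).

Lemma ps_comp_cellE :
  ps_comp_cell ≡ (pcell q ▹ T1 f) ⨾[comp1A' g (pact Y) (T1 f)] (g ◃ pcell p).
Proof. exact: recast_same. Qed.

Lemma ps_comp_inv : invertible ps_comp_cell.
Proof.
apply: recast_invertible; apply: along_invertible.
- by apply: whisker_r_invertible; apply: pcell_inv.
- by apply: whisker_l_invertible; apply: pcell_inv.
Qed.

Lemma ps_comp_unit : ps_comp_cell ▹ ι X ≡ id2 (g ∘ f).
Proof.
apply: same_trans (whisker_r_same eq_refl ps_comp_cellE) _.
rewrite whisker_r_along.
have H : pcell q ▹ T1 f ▹ ι X ≡ id2 (g ∘ f).
  apply: same_trans (same_sym (whisker_rA _ _ _)) _; rewrite nat_ι.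
  apply: same_trans (whisker_rA _ _ _) _.
  by apply: whisker_id_r; apply: pcell_unit.
apply: same_trans (along_id_l _ _ H) _.
apply: same_trans (same_sym (whisker_lr _ _ _)) _.
by apply: whisker_id_l; apply: pcell_unit.
Qed.

Lemma ps_comp_coh :
  (pact Z ◃ T2 ps_comp_cell)
    ⨾[act_comp (pact Z) (g ∘ f) (pact X)] (ps_comp_cell ▹ T1 (pact X))
    ⨾[comp1A' (g ∘ f) (pact X) (T1 (pact X))] ((g ∘ f) ◃ passoc X) ≡
  (passoc Z ▹ T1 (T1 (g ∘ f)))
    ⨾[act_nat_μ (pact Z) (g ∘ f)] (ps_comp_cell ▹ μ X).
Proof.
set κ := pcell q; set ζ := pcell p.
set a := κ ▹ T1 f; set b := g ◃ ζ.
have Ef := pcell_coh p; have Eg := pcell_coh q; rewrite -/κ -/ζ in Ef Eg.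
apply: along_trans_ll => [||e1 e2].
- exact: whisker_l_same (fmap2_same T ps_comp_cellE).
- exact: whisker_r_same ps_comp_cellE.
apply: same_sym.
apply: along_trans_r => [|e3]; first exact: whisker_r_same ps_comp_cellE.
apply: same_sym.
rewrite -/κ -/ζ !(fmap2_along, whisker_l_along, whisker_r_along) !alongA.
rewrite -[X in vcomp_along _ X _]alongA.
apply: along_trans_rr => [||e4 e5].
- apply: (@along_swap _ _ _ _ _ _ _ _ _ _ _ _ _ _ _ κ (T2 ζ)).
    apply: same_trans (whisker_lA _ _ _).
    by apply: whisker_l_same => //; apply: fmap2_whisker_l.
  rewrite fmap_comp; exact: same_sym (whisker_rA _ _ _).
- exact: same_cell_refl.
rewrite !alongA.
(* coherence of [p] in the last three factors *)
have Ef' := whisker_l_same (eq_refl g) Ef.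
rewrite !whisker_l_along alongA in Ef'.
rewrite -alongA.
apply: along_trans_r => [|e6].
  apply: same_trans Ef'; apply: along_same.
    exact: same_sym (whisker_lA _ _ _).
  apply: along_same; first exact: same_sym (whisker_lr _ _ _).
  exact: same_sym (whisker_lA _ _ _).
rewrite alongA -[X in vcomp_along _ X _]alongA -alongA.
(* coherence of [q] in the first three factors *)
have Eg' := whisker_r_same (eq_refl (T1 (T1 f))) Eg.
rewrite !whisker_r_along alongA in Eg'.
apply: along_trans_l => [|e7].
  apply: same_trans Eg'; apply: along_same; last apply: along_same.
  - apply: same_trans (whisker_lr _ _ _).
    by apply: whisker_l_same => //; apply: fmap2_whisker_r.
  - by rewrite fmap_comp; apply: whisker_rA.
  - exact: whisker_lr.
rewrite alongA; apply: along_same.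
  by rewrite !fmap_comp; apply: same_sym (whisker_rA _ _ _).
apply: along_same; last exact: whisker_lr.
apply: same_trans (same_sym (whisker_rA _ _ _)) _; rewrite nat_μ.
exact: whisker_rA.
Qed.

Definition ps_comp : PsHom X Z :=
  @Build_PsHom X Z (g ∘ f) ps_comp_cell ps_comp_inv ps_comp_unit ps_comp_coh.
End Composition.

Definition is_alg_cell (X Y : PsAlgebra) (f g : PsHom X Y)
    (λ : cell (phom f) (phom g)) : Prop :=
  vcomp (pact Y ◃ T2 λ) (pcell g) = vcomp (pcell f) (λ ▹ pact X).

Definition PsCell (X Y : PsAlgebra) (f g : PsHom X Y) : Type :=
  {λ : cell (phom f) (phom g) | is_alg_cell λ}.

Lemma PsCell_eq (X Y : PsAlgebra) (f g : PsHom X Y) (α β : PsCell f g) :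
  proj1_sig α = proj1_sig β -> α = β.
Proof.
case: α => a Ha; case: β => b Hb /= E; subst b.
by rewrite (proof_irrelevance _ Ha Hb).
Qed.

Lemma PsCell_same (X Y : PsAlgebra) (f g f' g' : PsHom X Y)
    (α : PsCell f g) (β : PsCell f' g') :
  f = f' -> g = g' -> proj1_sig α ≡ proj1_sig β ->
  @same_cell _ (@PsCell X Y) _ _ α _ _ β.
Proof.
move=> E E'; subst f' g' => /same_eq /PsCell_eq ->; exact: same_cell_refl.
Qed.

Lemma ps_id2_law (X Y : PsAlgebra) (f : PsHom X Y) :
  @is_alg_cell X Y f f (id2 (phom f)).
Proof.
by rewrite /is_alg_cell fmap2_id !hcomp_id2 vcomp_id_l vcomp_id_r.
Qed.

Lemma ps_vcomp_law (X Y : PsAlgebra) (f g h : PsHom X Y)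
    (α : PsCell f g) (β : PsCell g h) :
  @is_alg_cell X Y f h (vcomp (proj1_sig α) (proj1_sig β)).
Proof.
case: α => a Ha; case: β => b Hb /=; rewrite /is_alg_cell in Ha Hb *.
rewrite fmap2_vcomp whisker_l_vcomp whisker_r_vcomp.
by rewrite -vcompA Hb vcompA Ha vcompA.
Qed.

Lemma ps_hcomp_law (X Y Z : PsAlgebra) (g g' : PsHom Y Z) (f f' : PsHom X Y)
    (β : PsCell g g') (α : PsCell f f') :
  @is_alg_cell X Z (ps_comp g f) (ps_comp g' f')
    (proj1_sig β ∗ proj1_sig α).
Proof.
case: α => a Ha; case: β => b Hb /=; rewrite /is_alg_cell in Ha Hb *.
have P : vcomp ((pact Z ◃ T2 b) ∗ T2 a) (pcell g' ▹ T1 (phom f')) =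
         vcomp (pcell g ▹ T1 (phom f)) ((b ▹ pact Y) ∗ T2 a).
  by rewrite -!interchange Hb vcomp_id_l vcomp_id_r.
have Q : vcomp (b ∗ (pact Y ◃ T2 a)) (phom g' ◃ pcell f') =
         vcomp (phom g ◃ pcell f) (b ∗ (a ▹ pact X)).
  by rewrite -!interchange Ha vcomp_id_l vcomp_id_r.
apply: same_eq; set e0 := comp1A' (phom g) (pact Y) (T1 (phom f)).
apply: (@same_trans _ _ _ _ _ _ _ _ _ _
  ((pcell g ▹ T1 (phom f)) ⨾[e0] vcomp (phom g ◃ pcell f) (b ∗ (a ▹ pact X)))).
- rewrite -Q -(along_vcomp eq_refl) -(along_vcomp eq_refl (b ∗ _)).
  apply: along_trans_r => [|e1]; first exact: ps_comp_cellE.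
  rewrite -alongA.
  apply: along_trans_ll => [||e2 e3].
  + apply: same_trans (hcompA _ _ _).
    by apply: whisker_l_same => //; apply: fmap2_hcomp.
  + exact: same_cell_refl.
  rewrite along_vcomp P -(along_vcomp eq_refl) !alongA.
  apply: along_same => //; apply: along_same => //.
  exact: same_sym (hcompA _ _ _).
- rewrite -(along_vcomp eq_refl) -(along_vcomp eq_refl (ps_comp_cell _ _)).
  apply: same_sym; apply: along_trans_l => [|e1]; first exact: ps_comp_cellE.
  rewrite alongA; apply: along_same => //; apply: along_same => //.
  exact: same_sym (hcompA _ _ _).
Qed.

Lemma ps_id1_l (X Y : PsAlgebra) (f : PsHom X Y) : ps_comp (ps_id Y) f = f.
Proof.
apply: PsHom_eq => /=; first exact: id1_l.
apply: same_trans (ps_comp_cellE (ps_id Y) f) _.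
apply: same_trans (along_id_l _ _ _) _.
  by apply: whisker_id_r; apply: eqcell_same.
exact: hcomp_id_l.
Qed.

Lemma ps_id1_r (X Y : PsAlgebra) (f : PsHom X Y) : ps_comp f (ps_id X) = f.
Proof.
apply: PsHom_eq => /=; first exact: id1_r.
apply: same_trans (ps_comp_cellE f (ps_id X)) _.
apply: same_trans (along_id_r _ _ _) _.
  by apply: whisker_id_l; apply: eqcell_same.
by rewrite fmap_id; apply: hcomp_id_r.
Qed.

Lemma ps_comp1A (X Y Z W : PsAlgebra) (h : PsHom Z W) (g : PsHom Y Z)
    (f : PsHom X Y) : ps_comp h (ps_comp g f) = ps_comp (ps_comp h g) f.
Proof.
apply: PsHom_eq => /=; first exact: comp1A.
apply: same_trans (ps_comp_cellE h (ps_comp g f)) (same_sym _).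
apply: same_trans (ps_comp_cellE (ps_comp h g) f) (same_sym _).
apply: along_trans_r => [|e1].
  exact: whisker_l_same (ps_comp_cellE g f).
apply: same_sym; apply: along_trans_l => [|e2].
  exact: whisker_r_same (ps_comp_cellE h g).
apply: same_sym; rewrite whisker_l_along whisker_r_along alongA.
apply: along_same.
  by rewrite fmap_comp; apply: whisker_rA.
by apply: along_same; [apply: whisker_lr | apply: whisker_lA].
Qed.

Definition ps_id2 (X Y : PsAlgebra) (f : PsHom X Y) : PsCell f f :=
  exist _ _ (ps_id2_law f).

Definition ps_vcomp (X Y : PsAlgebra) (f g h : PsHom X Y)
    (α : PsCell f g) (β : PsCell g h) : PsCell f h :=
  exist _ _ (ps_vcomp_law α β).

Definition ps_hcomp (X Y Z : PsAlgebra) (g g' : PsHom Y Z) (f f' : PsHom X Y)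
    (β : PsCell g g') (α : PsCell f f') :
    PsCell (ps_comp g f) (ps_comp g' f') :=
  exist _ _ (ps_hcomp_law β α).

Lemma ps_vcomp_id_l (X Y : PsAlgebra) (f g : PsHom X Y) (α : PsCell f g) :
  ps_vcomp (ps_id2 f) α = α.
Proof. by apply: PsCell_eq; apply: vcomp_id_l. Qed.

Lemma ps_vcomp_id_r (X Y : PsAlgebra) (f g : PsHom X Y) (α : PsCell f g) :
  ps_vcomp α (ps_id2 g) = α.
Proof. by apply: PsCell_eq; apply: vcomp_id_r. Qed.

Lemma ps_vcompA (X Y : PsAlgebra) (f g h k : PsHom X Y)
    (α : PsCell f g) (β : PsCell g h) (γ : PsCell h k) :
  ps_vcomp α (ps_vcomp β γ) = ps_vcomp (ps_vcomp α β) γ.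
Proof. by apply: PsCell_eq; apply: vcompA. Qed.

Lemma ps_hcomp_id2 (X Y Z : PsAlgebra) (g : PsHom Y Z) (f : PsHom X Y) :
  ps_hcomp (ps_id2 g) (ps_id2 f) = ps_id2 (ps_comp g f).
Proof. by apply: PsCell_eq; apply: hcomp_id2. Qed.

Lemma ps_interchange (X Y Z : PsAlgebra) (g g' g'' : PsHom Y Z)
    (f f' f'' : PsHom X Y) (β : PsCell g g') (β' : PsCell g' g'')
    (α : PsCell f f') (α' : PsCell f' f'') :
  ps_hcomp (ps_vcomp β β') (ps_vcomp α α') =
  ps_vcomp (ps_hcomp β α) (ps_hcomp β' α').
Proof. by apply: PsCell_eq; apply: interchange. Qed.

Lemma ps_hcomp_id_l (X Y : PsAlgebra) (f g : PsHom X Y) (α : PsCell f g) :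
  @same_cell _ (@PsCell X Y) _ _ (ps_hcomp (ps_id2 (ps_id Y)) α) _ _ α.
Proof.
by apply: PsCell_same; rewrite ?ps_id1_l //=; apply: hcomp_id_l.
Qed.

Lemma ps_hcomp_id_r (X Y : PsAlgebra) (f g : PsHom X Y) (α : PsCell f g) :
  @same_cell _ (@PsCell X Y) _ _ (ps_hcomp α (ps_id2 (ps_id X))) _ _ α.
Proof.
by apply: PsCell_same; rewrite ?ps_id1_r //=; apply: hcomp_id_r.
Qed.

Lemma ps_hcompA (X Y Z W : PsAlgebra) (h h' : PsHom Z W) (g g' : PsHom Y Z)
    (f f' : PsHom X Y) (γ : PsCell h h') (β : PsCell g g') (α : PsCell f f') :
  @same_cell _ (@PsCell X W) _ _ (ps_hcomp γ (ps_hcomp β α))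
    _ _ (ps_hcomp (ps_hcomp γ β) α).
Proof.
by apply: PsCell_same; rewrite ?ps_comp1A //=; apply: hcompA.
Qed.

Definition PsAlg : TwoCat :=
  @Build_TwoCat PsAlgebra PsHom PsCell ps_id
    (fun X Y Z g f => ps_comp g f) ps_id2 ps_vcomp ps_hcomp
    ps_id1_l ps_id1_r ps_comp1A ps_vcomp_id_l ps_vcomp_id_r ps_vcompA
    ps_hcomp_id2 ps_interchange ps_hcomp_id_l ps_hcomp_id_r ps_hcompA.

Record StAlgebra := {
  scar :> K;
  sact : hom (T scar) scar;
  sact_unit : sact ∘ ι scar = id1 scar;
  sact_assoc : sact ∘ T1 sact = sact ∘ μ scar
}.

Section StrictIsPseudo.
Variable X : StAlgebra.
Local Notation θ := (sact X).
Local Notation φ := (eqcell (sact_assoc X)).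

Lemma st_unit_l : is_identity (φ ▹ ι (T X)).
Proof. exact: is_identity_same (whisker_id_r _ (eqcell_same _)). Qed.

Lemma st_unit_r : is_identity (φ ▹ T1 (ι X)).
Proof. exact: is_identity_same (whisker_id_r _ (eqcell_same _)). Qed.

Lemma st_coh :
  (φ ▹ T1 (T1 θ)) ⨾[act_nat_μ θ θ] (φ ▹ μ (T X)) ≡
  (θ ◃ T2 φ) ⨾[act_comp θ θ (μ X)] (φ ▹ T1 (μ X)).
Proof.
apply: same_trans (along_id_l _ _ _) _.
  by apply: whisker_id_r; apply: eqcell_same.
apply: same_trans (whisker_id_r _ (eqcell_same _)) (same_sym _).
apply: same_trans (along_id_l _ _ _) _.
  by apply: whisker_id_l; apply: fmap2_is_id; apply: eqcell_same.
apply: same_trans (whisker_id_r _ (eqcell_same _)) (id2_same _).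
by rewrite sact_assoc -!comp1A monad_assoc.
Qed.

Definition st_ps : PsAlgebra :=
  @Build_PsAlgebra X θ φ (sact_unit X) (eqcell_invertible _)
    st_unit_l st_unit_r st_coh.
End StrictIsPseudo.

Definition is_strict (X Y : PsAlgebra) (f : PsHom X Y) : Prop :=
  is_identity (pcell f).

Lemma strict_id (X : PsAlgebra) : is_strict (ps_id X).
Proof. exact: eqcell_same. Qed.

Lemma strict_comp (X Y Z : PsAlgebra) (g : PsHom Y Z) (f : PsHom X Y) :
  is_strict g -> is_strict f -> is_strict (ps_comp g f).
Proof.
move=> Hg Hf; apply: is_identity_same (same_trans (ps_comp_cellE g f) _).
apply: same_trans (along_id_l _ _ (whisker_id_r _ Hg)) _.
exact: whisker_id_l Hf.
Qed.

Definition StHom (X Y : StAlgebra) : Type :=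
  {f : PsHom (st_ps X) (st_ps Y) | is_strict f}.

Definition st_id (X : StAlgebra) : StHom X X :=
  exist _ _ (strict_id (st_ps X)).

Definition st_comp (X Y Z : StAlgebra) (g : StHom Y Z) (f : StHom X Y) :
    StHom X Z :=
  exist _ _ (strict_comp (proj2_sig g) (proj2_sig f)).

Lemma StHom_eq (X Y : StAlgebra) (f g : StHom X Y) :
  proj1_sig f = proj1_sig g -> f = g.
Proof.
case: f => f Hf; case: g => g Hg /= E; subst g.
by rewrite (proof_irrelevance _ Hf Hg).
Qed.

Definition StCell (X Y : StAlgebra) (f g : StHom X Y) : Type :=
  PsCell (proj1_sig f) (proj1_sig g).

Lemma StCell_same (X Y : StAlgebra) (f g f' g' : StHom X Y)
    (α : StCell f g) (β : StCell f' g') :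
  f = f' -> g = g' ->
  @same_cell _ (@PsCell (st_ps X) (st_ps Y)) _ _ α _ _ β ->
  @same_cell _ (@StCell X Y) _ _ α _ _ β.
Proof.
move=> E E'; subst f' g' => /(@same_eq PsAlg) ->; exact: same_cell_refl.
Qed.

Lemma st_id1_l (X Y : StAlgebra) (f : StHom X Y) : st_comp (st_id Y) f = f.
Proof. by apply: StHom_eq; apply: ps_id1_l. Qed.

Lemma st_id1_r (X Y : StAlgebra) (f : StHom X Y) : st_comp f (st_id X) = f.
Proof. by apply: StHom_eq; apply: ps_id1_r. Qed.

Lemma st_comp1A (X Y Z W : StAlgebra) (h : StHom Z W) (g : StHom Y Z)
    (f : StHom X Y) : st_comp h (st_comp g f) = st_comp (st_comp h g) f.
Proof. by apply: StHom_eq; apply: ps_comp1A. Qed.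

Definition st_id2 (X Y : StAlgebra) (f : StHom X Y) : StCell f f :=
  ps_id2 (proj1_sig f).

Definition st_vcomp (X Y : StAlgebra) (f g h : StHom X Y)
    (α : StCell f g) (β : StCell g h) : StCell f h := ps_vcomp α β.

Definition st_hcomp (X Y Z : StAlgebra) (g g' : StHom Y Z) (f f' : StHom X Y)
    (β : StCell g g') (α : StCell f f') :
    StCell (st_comp g f) (st_comp g' f') := ps_hcomp β α.

Lemma st_hcomp_id_l (X Y : StAlgebra) (f g : StHom X Y) (α : StCell f g) :
  @same_cell _ (@StCell X Y) _ _ (st_hcomp (st_id2 (st_id Y)) α) _ _ α.
Proof. by apply: StCell_same; rewrite ?st_id1_l //; apply: ps_hcomp_id_l. Qed.

Lemma st_hcomp_id_r (X Y : StAlgebra) (f g : StHom X Y) (α : StCell f g) :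
  @same_cell _ (@StCell X Y) _ _ (st_hcomp α (st_id2 (st_id X))) _ _ α.
Proof. by apply: StCell_same; rewrite ?st_id1_r //; apply: ps_hcomp_id_r. Qed.

Lemma st_hcompA (X Y Z W : StAlgebra) (h h' : StHom Z W) (g g' : StHom Y Z)
    (f f' : StHom X Y) (γ : StCell h h') (β : StCell g g') (α : StCell f f') :
  @same_cell _ (@StCell X W) _ _ (st_hcomp γ (st_hcomp β α))
    _ _ (st_hcomp (st_hcomp γ β) α).
Proof. by apply: StCell_same; rewrite ?st_comp1A //; apply: ps_hcompA. Qed.

Definition AlgSt : TwoCat :=
  @Build_TwoCat StAlgebra StHom StCell st_id
    (fun X Y Z g f => st_comp g f) st_id2 st_vcomp st_hcomp
    st_id1_l st_id1_r st_comp1A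
    (fun X Y f g α => ps_vcomp_id_l α) (fun X Y f g α => ps_vcomp_id_r α)
    (fun X Y f g h k α β γ => ps_vcompA α β γ)
    (fun X Y Z g f => ps_hcomp_id2 (proj1_sig g) (proj1_sig f))
    (fun X Y Z g g' g'' f f' f'' β β' α α' => ps_interchange β β' α α')
    st_hcomp_id_l st_hcomp_id_r st_hcompA.

Definition inclusion : TwoFunctor AlgSt PsAlg :=
  @Build_TwoFunctor AlgSt PsAlg st_ps
    (fun (X Y : StAlgebra) (f : StHom X Y) => proj1_sig f)
    (fun X Y f g α => α)
    (fun X => eq_refl) (fun X Y Z g f => eq_refl) (fun X Y f => eq_refl)
    (fun X Y f g h α β => eq_refl)
    (fun X Y Z g g' f f' β α => @same_cell_refl _ (@cell PsAlg _ _) _ _ _).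

End Algebras.

Arguments PsAlg {K} T.
Arguments AlgSt {K} T.
Arguments inclusion {K} T.

(* Main.v *)
From Stdlib Require Import ProofIrrelevance ClassicalEpsilon.
From mathcomp Require Import ssreflect ssrfun ssrbool.
Require Import Defs.

(** Factor the action of a pseudoalgebra X as θ = m e with e : TX → I in E and
    m in M. Since Te is in E, the invertible cell φ : θ Tθ ⇒ θ μ fills the square
    of Te against m: this gives ξ : TI → I and ψ : θ Tm ⇒ m ξ, and uniqueness
    of fillers makes (I, ξ) a strict algebra and (m, ψ) a pseudomorphism. The
    1-cell n = e ι satisfies m n = id, so by rigidity n m ≅ id, and this can be
    corrected to α : id ⇒ n m with m α and α n trivial. Then (n, α e) is a
    pseudomorphism X → I. Given (f, κ) : X → Z with Z strict, filling κ⁻¹ for e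
    against id_Z gives g : I → Z and χ : g ⇒ f m; comparing along n shows
    χ = g α, which makes (g strict) ∘ (n, α e) = (f, κ) with g unique. Hence
    X → I is universal, in dimension 2 because n is an equivalence. *)

Set Implicit Arguments.
Unset Strict Implicit.
Unset Printing Implicit Defensive.

Local Open Scope twocat_scope.

(* Packing a 2-cell with its boundary turns [≡] into Leibniz equality, so that
   [⊛] is strictly associative and pastings can be computed by rewriting. *)
Record Arrow (K : TwoCat) (X Y : K) :=
  Tot { src : hom X Y; tgt : hom X Y; arr : cell src tgt }.
Arguments Tot {K X Y src tgt} _.

(** As a coercion this lets a 1-cell stand for its identity 2-cell, so whiskering is [⊛] with a
    1-cell and [a = f] says that [a] is the identity of [f]. *)
Definition one (K : TwoCat) (X Y : K) (f : hom X Y) : Arrow X Y := Tot (id2 f).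
Coercion one : hom >-> Arrow.

Definition hT (K : TwoCat) (X Y Z : K) (b : Arrow Y Z) (a : Arrow X Y) :
  Arrow X Z := Tot (arr b ∗ arr a).

(* Cells that do not match compose to the junk value [a]; every use of [a ⨟ b]
   therefore carries a side condition [tgt a = src b]. *)
Definition vT (K : TwoCat) (X Y : K) (a b : Arrow X Y) : Arrow X Y :=
  match excluded_middle_informative (tgt a = src b) with
  | left e => Tot (vcomp_along (arr a) (arr b) e)
  | right _ => a
  end.

Definition mapT (K L : TwoCat) (F : TwoFunctor K L) (X Y : K) (a : Arrow X Y) :
  Arrow (F X) (F Y) := Tot (fmap2 F (arr a)).

Notation "b ⊛ a" := (hT b a) (at level 40, left associativity) : twocat_scope.
Notation "a ⨟ b" := (vT a b) (at level 50, left associativity) : twocat_scope.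

(** The boundary equations come first because [⨟] is meaningful only on matching cells. *)
Definition invT (K : TwoCat) (X Y : K) (a b : Arrow X Y) : Prop :=
  [/\ src b = tgt a, tgt b = src a, a ⨟ b = src a & b ⨟ a = tgt a].

(** * Calculus of packed 2-cells *)

Section Calculus.
Variable K : TwoCat.
Implicit Types X Y Z W : K.

Lemma TotP X Y (f g f' g' : hom X Y) (α : cell f g) (β : cell f' g') :
  α ≡ β -> Tot α = Tot β.
Proof. by case. Qed.

Lemma Tot_same X Y (f g f' g' : hom X Y) (α : cell f g) (β : cell f' g') :
  Tot α = Tot β -> α ≡ β.
Proof.
suff H (a b : Arrow X Y) : a = b -> arr a ≡ arr b by move/H.
by move=> ->.
Qed.

Lemma Tot_inj X Y (f g : hom X Y) (α β : cell f g) : Tot α = Tot β -> α = β.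
Proof. by move/Tot_same/same_eq. Qed.

Lemma Tot_arr X Y (a : Arrow X Y) : Tot (arr a) = a.
Proof. by case: a. Qed.

Lemma vT_along X Y (f g g' h : hom X Y) (e : g = g') (α : cell f g)
    (β : cell g' h) : Tot (vcomp_along α β e) = Tot α ⨟ Tot β.
Proof.
rewrite /vT /=; case: excluded_middle_informative => // e'.
by rewrite (proof_irrelevance _ e e').
Qed.

Lemma vT_vcomp X Y (f g h : hom X Y) (α : cell f g) (β : cell g h) :
  Tot (vcomp α β) = Tot α ⨟ Tot β.
Proof. by rewrite -(vT_along eq_refl) along_vcomp. Qed.

Lemma Tot_eqcell X Y (f g : hom X Y) (e : f = g) : Tot (eqcell e) = f.
Proof. exact/TotP/eqcell_same. Qed.

Lemma src_vT X Y (a b : Arrow X Y) : src (a ⨟ b) = src a.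
Proof. by rewrite /vT; case: excluded_middle_informative. Qed.

Lemma tgt_vT X Y (a b : Arrow X Y) : tgt a = src b -> tgt (a ⨟ b) = tgt b.
Proof. by rewrite /vT; case: excluded_middle_informative. Qed.

Lemma vTA X Y (a b c : Arrow X Y) : tgt a = src b -> tgt b = src c ->
  a ⨟ (b ⨟ c) = a ⨟ b ⨟ c.
Proof.
case: a b c => f g a [g' h b] [h' k c] /= e e'; subst g' h'.
by rewrite -!vT_vcomp vcompA.
Qed.

Lemma vT1l X Y (f : hom X Y) (a : Arrow X Y) : src a = f -> f ⨟ a = a.
Proof. by case: a => g h a /= <-; rewrite -vT_vcomp vcomp_id_l. Qed.

Lemma vT1r X Y (f : hom X Y) (a : Arrow X Y) : tgt a = f -> a ⨟ f = a.
Proof. by case: a => g h a /= <-; rewrite -vT_vcomp vcomp_id_r. Qed.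

Lemma hTA X Y Z W (c : Arrow Z W) (b : Arrow Y Z) (a : Arrow X Y) :
  c ⊛ (b ⊛ a) = c ⊛ b ⊛ a.
Proof. exact/TotP/hcompA. Qed.

Lemma hT1 X Y Z (g : hom Y Z) (f : hom X Y) : g ⊛ f = g ∘ f.
Proof. by rewrite /hT /= hcomp_id2. Qed.

Lemma hT1l X Y (a : Arrow X Y) : id1 Y ⊛ a = a.
Proof. by rewrite -[RHS]Tot_arr; apply/TotP/hcomp_id_l. Qed.

Lemma hT1r X Y (a : Arrow X Y) : a ⊛ id1 X = a.
Proof. by rewrite -[RHS]Tot_arr; apply/TotP/hcomp_id_r. Qed.

Lemma hTMl X Y Z W (h : hom Z W) (g : hom Y Z) (a : Arrow X Y) :
  (h ∘ g) ⊛ a = h ⊛ (g ⊛ a).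
Proof. by rewrite hTA hT1. Qed.

Lemma hTMr X Y Z W (a : Arrow Z W) (g : hom Y Z) (f : hom X Y) :
  a ⊛ (g ∘ f) = a ⊛ g ⊛ f.
Proof. by rewrite -hTA hT1. Qed.

Lemma hTv X Y Z (b b' : Arrow Y Z) (a a' : Arrow X Y) :
  tgt b = src b' -> tgt a = src a' ->
  (b ⨟ b') ⊛ (a ⨟ a') = (b ⊛ a) ⨟ (b' ⊛ a').
Proof.
case: b b' a a' => b1 b2 b [b3 b4 b'] [a1 a2 a] [a3 a4 a'] /= E E'; subst b3 a3.
by rewrite -!vT_vcomp {1}/hT /= interchange vT_vcomp.
Qed.

Lemma hTvl X Y Z (g : hom Y Z) (a a' : Arrow X Y) : tgt a = src a' ->
  g ⊛ (a ⨟ a') = (g ⊛ a) ⨟ (g ⊛ a').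
Proof. by move=> E; rewrite -hTv // vT1l. Qed.

Lemma hTvr X Y Z (b b' : Arrow Y Z) (f : hom X Y) : tgt b = src b' ->
  (b ⨟ b') ⊛ f = (b ⊛ f) ⨟ (b' ⊛ f).
Proof. by move=> E; rewrite -hTv // vT1l. Qed.

(** With [slide_l], the two factorizations of a horizontal composite; equating them slides [b] past
    [a]. *)
Lemma slide_r X Y Z (b : Arrow Y Z) (a : Arrow X Y) :
  (b ⊛ src a) ⨟ (tgt b ⊛ a) = b ⊛ a.
Proof. by rewrite -hTv // vT1l ?vT1r. Qed.

Lemma slide_l X Y Z (b : Arrow Y Z) (a : Arrow X Y) :
  (src b ⊛ a) ⨟ (b ⊛ tgt a) = b ⊛ a.
Proof. by rewrite -hTv // vT1l ?vT1r. Qed.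

Lemma invTC X Y (a b : Arrow X Y) : invT a b -> invT b a.
Proof. by case=> E E' H H'; split; rewrite ?E ?E'. Qed.

Lemma invT1 X Y (f : hom X Y) : invT f f.
Proof. by split; rewrite //= vT1l. Qed.

Lemma invT_v X Y (a b a' b' : Arrow X Y) : tgt a = src b ->
  invT a a' -> invT b b' -> invT (a ⨟ b) (b' ⨟ a').
Proof.
move=> E [A1 A2 A3 A4] [B1 B2 B3 B4].
have E' : tgt b' = src a' by rewrite B2 A1.
split; rewrite ?src_vT ?tgt_vT //.
- rewrite vTA ?tgt_vT // -[a ⨟ b ⨟ b']vTA // B3 vT1r ?A3 //.
- rewrite vTA ?tgt_vT // -[b' ⨟ a' ⨟ a]vTA // A4 vT1r ?B4 //.
  by rewrite E B2.
Qed.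

Lemma invT_h X Y Z (b b' : Arrow Y Z) (a a' : Arrow X Y) :
  invT b b' -> invT a a' -> invT (b ⊛ a) (b' ⊛ a').
Proof.
move=> [B1 B2 B3 B4] [A1 A2 A3 A4].
split; rewrite /= ?B1 ?A1 ?B2 ?A2 // -hTv //.
- by rewrite B3 A3 hT1.
- by rewrite B4 A4 hT1.
Qed.

Lemma invT_hl X Y Z (g : hom Y Z) (a a' : Arrow X Y) :
  invT a a' -> invT (g ⊛ a) (g ⊛ a').
Proof. by move=> H; apply: invT_h => //; apply: invT1. Qed.

Lemma invT_hr X Y Z (b b' : Arrow Y Z) (f : hom X Y) :
  invT b b' -> invT (b ⊛ f) (b' ⊛ f).
Proof. by move=> H; apply: invT_h => //; apply: invT1. Qed.

Lemma invT_cancel_r X Y (a b c c' : Arrow X Y) : invT c c' ->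
  tgt a = src c -> tgt b = src c -> a ⨟ c = b ⨟ c -> a = b.
Proof.
move=> [C1 C2 C3 C4] E E' H.
by rewrite -(vT1r E) -(vT1r E') -C3 !vTA // H.
Qed.

Lemma invT_swap X Y (a b c : Arrow X Y) : invT a c -> tgt a = src b ->
  tgt b = src a -> a ⨟ b = src a -> b ⨟ a = tgt a.
Proof.
move=> [C1 C2 C3 C4] E E' H.
suff -> : b = c by [].
by rewrite -[LHS](vT1l (esym E)) -C4 -vTA // H vT1r.
Qed.

Lemma invT_uniq X Y (a b c : Arrow X Y) : invT a b -> invT a c -> b = c.
Proof.
move=> [B1 B2 B3 B4] [C1 C2 C3 C4].
rewrite -[LHS](vT1r B2) -C3 vTA // B4 vT1l //.
Qed.

Lemma invertible_invT X Y (f g : hom X Y) (α : cell f g) :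
  invertible α <-> exists b, invT (Tot α) b.
Proof.
split.
  move=> [β [H H']]; exists (Tot β); split => //; rewrite -vT_vcomp /=.
    by rewrite H.
  by rewrite H'.
move=> [[f' g' β] [/= E E' H H']]; subst f' g'; exists β.
by split; apply: Tot_inj; rewrite vT_vcomp.
Qed.

Lemma is_identityT X Y (f g : hom X Y) (α : cell f g) :
  is_identity α <-> Tot α = f.
Proof. by split=> [/TotP|/Tot_same]. Qed.

End Calculus.

(** * Action of a 2-functor on packed 2-cells *)

Section Map.
Variables (K L : TwoCat) (F : TwoFunctor K L).
Implicit Types X Y Z : K.

Lemma mapT1 X Y (f : hom X Y) : mapT F f = fmap F f.
Proof. by rewrite /mapT /= fmap2_id. Qed.

Lemma mapTh X Y Z (b : Arrow Y Z) (a : Arrow X Y) :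
  mapT F (b ⊛ a) = mapT F b ⊛ mapT F a.
Proof. exact/TotP/fmap2_hcomp. Qed.

Lemma mapThl X Y Z (g : hom Y Z) (a : Arrow X Y) :
  mapT F (g ⊛ a) = fmap F g ⊛ mapT F a.
Proof. by rewrite mapTh mapT1. Qed.

Lemma mapThr X Y Z (b : Arrow Y Z) (f : hom X Y) :
  mapT F (b ⊛ f) = mapT F b ⊛ fmap F f.
Proof. by rewrite mapTh mapT1. Qed.

Lemma mapTv X Y (a b : Arrow X Y) : tgt a = src b ->
  mapT F (a ⨟ b) = mapT F a ⨟ mapT F b.
Proof.
case: a b => f g a [g' h b] /= E; subst g'.
by rewrite -vT_vcomp /mapT /= fmap2_vcomp vT_vcomp.
Qed.

Lemma mapT_inv X Y (a b : Arrow X Y) : invT a b -> invT (mapT F a) (mapT F b).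
Proof.
move=> [A1 A2 A3 A4]; split; rewrite /= ?A1 ?A2 // -mapTv //.
  by rewrite A3 mapT1.
by rewrite A4 mapT1.
Qed.
End Map.

(** The way back from packed cells, for record fields that prescribe the boundary. *)
Definition castT (K : TwoCat) (X Y : K) (f g : hom X Y) (a : Arrow X Y)
    (e : f = src a) (e' : tgt a = g) : cell f g := recast (arr a) e e'.

Lemma Tot_castT (K : TwoCat) (X Y : K) (f g : hom X Y) (a : Arrow X Y)
    (e : f = src a) (e' : tgt a = g) : Tot (castT e e') = a.
Proof. by rewrite -[RHS]Tot_arr; apply/TotP/recast_same. Qed.

(** * Adjunctions from universal arrows *)

(** Precomposition with [η] is an isomorphism of categories from [hom I Y] to [hom X (R Y)]:
    bijective on 1-cells, then fully faithful. *)
Definition is_universal_arrow (C D : TwoCat) (R : TwoFunctor D C) (X : C)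
    (I : D) (η : hom X (R I)) : Prop :=
  (forall (Y : D) (f : hom X (R Y)),
    exists! g : hom I Y, fmap R g ∘ η = f) /\
  (forall (Y : D) (g g' : hom I Y) (λ : cell (fmap R g ∘ η) (fmap R g' ∘ η)),
    exists! ρ : cell g g', fmap2 R ρ ▹ η = λ).

Section UniversalArrows.
Variables (C D : TwoCat) (R : TwoFunctor D C) (L0 : C -> D).
Variable η : forall X : C, hom X (R (L0 X)).
Hypothesis uη : forall X : C, is_universal_arrow (η X).

(** Uniqueness on 1-cells identifies the boundaries, after which uniqueness on 2-cells applies. The
    2-cell laws of the left adjoint are all checked this way, after whiskering with [η]. *)
Lemma universal_faithful X Y (r r' : Arrow (L0 X) Y) :
  mapT R r ⊛ η X = mapT R r' ⊛ η X -> r = r'.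
Proof.
case: r r' => g h r [g' h' r'] E.
have Hg : fmap R g ∘ η X = fmap R g' ∘ η X by exact: (congr1 (@src _ _ _) E).
have Hh : fmap R h ∘ η X = fmap R h' ∘ η X by exact: (congr1 (@tgt _ _ _) E).
have [u1 u2] := uη X.
have {}Hg : g = g'.
  by have [x [_ Ux]] := u1 _ (fmap R g' ∘ η X); rewrite -(Ux g) // -(Ux g').
have {}Hh : h = h'.
  by have [x [_ Ux]] := u1 _ (fmap R h' ∘ η X); rewrite -(Ux h) // -(Ux h').
subst g' h'; have [x [_ Ux]] := u2 _ _ _ (fmap2 R r' ▹ η X).
by rewrite -(Ux r') // (Ux r) //; apply: Tot_inj.
Qed.

Lemma universal_faithful1 X Y (g g' : hom (L0 X) Y) :
  fmap R g ∘ η X = fmap R g' ∘ η X -> g = g'.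
Proof.
move=> E; have [x [_ Ux]] := (uη X).1 _ (fmap R g' ∘ η X).
by rewrite -(Ux g) // -(Ux g').
Qed.

Lemma universal_ex X Y (f : hom X (R Y)) :
  exists g : hom (L0 X) Y, fmap R g ∘ η X = f.
Proof. by have [g [Hg _]] := (uη X).1 _ f; exists g. Qed.

Definition lift X Y (f : hom X (R Y)) : hom (L0 X) Y :=
  proj1_sig (constructive_indefinite_description _ (universal_ex f)).

Lemma liftE X Y (f : hom X (R Y)) : fmap R (lift f) ∘ η X = f.
Proof. by rewrite /lift; case: constructive_indefinite_description. Qed.

Lemma universal_ex2 X Y (f f' : hom X (R Y)) (α : cell f f') :
  exists ρ : cell (lift f) (lift f'), mapT R (Tot ρ) ⊛ η X = Tot α.
Proof.
have [ρ [Hρ _]] := (uη X).2 _ _ _ (recast α (liftE f) (esym (liftE f'))).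
exists ρ; rewrite -(TotP (recast_same α (liftE f) (esym (liftE f')))) -Hρ.
by [].
Qed.

Definition lift2 X Y (f f' : hom X (R Y)) (α : cell f f') :
    cell (lift f) (lift f') :=
  proj1_sig (constructive_indefinite_description _ (universal_ex2 α)).

Lemma lift2E X Y (f f' : hom X (R Y)) (α : cell f f') :
  mapT R (Tot (lift2 α)) ⊛ η X = Tot α.
Proof. by rewrite /lift2; case: constructive_indefinite_description. Qed.

Definition ladj_map X Y (f : hom X Y) : hom (L0 X) (L0 Y) := lift (η Y ∘ f).

Definition ladj_map2 X Y (f g : hom X Y) (α : cell f g) :
    cell (ladj_map f) (ladj_map g) := lift2 (η Y ◃ α).

Lemma ladj_mapE X Y (f : hom X Y) : fmap R (ladj_map f) ∘ η X = η Y ∘ f.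
Proof. exact: liftE. Qed.

Lemma ladj_map2E X Y (f g : hom X Y) (α : cell f g) :
  mapT R (Tot (ladj_map2 α)) ⊛ η X = η Y ⊛ Tot α.
Proof. exact: lift2E. Qed.

Lemma ladj_id X : ladj_map (id1 X) = id1 (L0 X).
Proof.
by apply: universal_faithful1; rewrite ladj_mapE fmap_id id1_l id1_r.
Qed.

Lemma ladj_comp X Y Z (g : hom Y Z) (f : hom X Y) :
  ladj_map (g ∘ f) = ladj_map g ∘ ladj_map f.
Proof.
apply: universal_faithful1; rewrite ladj_mapE fmap_comp -comp1A ladj_mapE.
by rewrite !comp1A ladj_mapE.
Qed.

Lemma ladj_id2 X Y (f : hom X Y) : ladj_map2 (id2 f) = id2 (ladj_map f).
Proof.
apply: Tot_inj; apply: universal_faithful; rewrite ladj_map2E.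
rewrite -[Tot (id2 f)]/(one f) -[Tot (id2 _)]/(one (ladj_map f)).
by rewrite mapT1 !hT1 ladj_mapE.
Qed.

Lemma ladj_vcomp X Y (f g h : hom X Y) (α : cell f g) (β : cell g h) :
  ladj_map2 (vcomp α β) = vcomp (ladj_map2 α) (ladj_map2 β).
Proof.
apply: Tot_inj; apply: universal_faithful; rewrite ladj_map2E !vT_vcomp.
by rewrite mapTv // hTvr // hTvl // !ladj_map2E.
Qed.

Lemma ladj_hcomp X Y Z (g g' : hom Y Z) (f f' : hom X Y)
    (β : cell g g') (α : cell f f') :
  ladj_map2 (β ∗ α) ≡ ladj_map2 β ∗ ladj_map2 α.
Proof.
apply: Tot_same; apply: universal_faithful; rewrite ladj_map2E.
rewrite -[Tot (β ∗ α)]/(Tot β ⊛ Tot α) -[Tot (_ ∗ _)]/(Tot _ ⊛ Tot _).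
by rewrite mapTh -hTA ladj_map2E !hTA ladj_map2E.
Qed.

Definition ladj : TwoFunctor C D :=
  @Build_TwoFunctor C D L0 ladj_map ladj_map2 ladj_id ladj_comp ladj_id2
    ladj_vcomp ladj_hcomp.

Lemma ladj_unit_nat2 X Y (f g : hom X Y) (α : cell f g) :
  η Y ◃ α ≡ fmap2 R (ladj_map2 α) ▹ η X.
Proof. by apply: Tot_same; apply: esym; apply: ladj_map2E. Qed.

Definition ladj_unit : TwoNat (fidentity C) (fcompose R ladj) :=
  @Build_TwoNat C C (fidentity C) (fcompose R ladj) η
    (fun X Y f => esym (ladj_mapE f)) ladj_unit_nat2.

Definition ladj_ev (Y : D) : hom (L0 (R Y)) Y := lift (id1 (R Y)).

Lemma ladj_evE Y : fmap R (ladj_ev Y) ∘ η (R Y) = id1 (R Y).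
Proof. exact: liftE. Qed.

Lemma ladj_ev_nat X Y (f : hom X Y) :
  ladj_ev Y ∘ ladj_map (fmap R f) = f ∘ ladj_ev X.
Proof.
apply: universal_faithful1; rewrite !fmap_comp -!comp1A ladj_mapE ladj_evE.
by rewrite comp1A ladj_evE id1_l id1_r.
Qed.

Lemma ladj_ev_nat2 X Y (f g : hom X Y) (α : cell f g) :
  ladj_ev Y ◃ ladj_map2 (fmap2 R α) ≡ α ▹ ladj_ev X.
Proof.
apply: Tot_same; apply: universal_faithful.
rewrite -[Tot (_ ▹ _)]/(Tot _ ⊛ ladj_ev X) -[Tot (_ ◃ _)]/(ladj_ev Y ⊛ Tot _).
rewrite !mapTh -!hTA ladj_map2E !mapT1 hT1 ladj_evE hT1r hTA hT1 ladj_evE.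
by rewrite hT1l.
Qed.

Definition ladj_counit : TwoNat (fcompose ladj R) (fidentity D) :=
  @Build_TwoNat D D (fcompose ladj R) (fidentity D) ladj_ev
    ladj_ev_nat ladj_ev_nat2.

Lemma ladj_triangle_l X :
  ladj_ev (L0 X) ∘ ladj_map (η X) = id1 (L0 X).
Proof.
apply: universal_faithful1.
by rewrite fmap_comp -comp1A ladj_mapE comp1A ladj_evE fmap_id !id1_l.
Qed.

Definition ladj_adjunction : TwoAdjunction ladj R :=
  @Build_TwoAdjunction C D ladj R ladj_unit ladj_counit ladj_triangle_l
    ladj_evE.
End UniversalArrows.

(** * Fillers and retract equivalences *)

Section Factorization.
Variables (K : TwoCat) (E M : cell1_class K).
Hypothesis hEM : is_EFS E M.

Lemma M_id (Z : K) : M (id1 Z).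
Proof. by apply: (M_iso hEM); exists (id1 Z); rewrite !id1_l. Qed.

Lemma fillT (A X B Y : K) (e : hom A X) (m : hom B Y) (v : hom A B)
    (u : hom X Y) (a a' : Arrow A Y) : E e -> M m -> invT a a' ->
    src a = u ∘ e -> tgt a = m ∘ v ->
  exists (w : hom X B) (b b' : Arrow X Y),
    [/\ invT b b', src b = u, tgt b = m ∘ w, w ∘ e = v & b ⊛ e = a].
Proof.
move=> He Hm Ha S T; case: a Ha S T => f g α /= Ha S T; subst f g.
have iα : invertible α by apply/invertible_invT; exists a'.
have [w [φ [[/invertible_invT [b' Hb] [Hw Hφ]] _]]] := EFS_fill hEM He Hm iα.
by exists w, (Tot φ), b'; split => //; apply: TotP.
Qed.

(** Both pairs fill the square [b ⊛ e], once its target is reassociated to [m ∘ (w ∘ e)]. *)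
Lemma fillT_uniq (A X B Y : K) (e : hom A X) (m : hom B Y)
    (w w' : hom X B) (b c b' c' : Arrow X Y) : E e -> M m ->
    invT b c -> invT b' c' -> src b = src b' ->
    tgt b = m ∘ w -> tgt b' = m ∘ w' -> w ∘ e = w' ∘ e -> b ⊛ e = b' ⊛ e ->
  w = w' /\ b = b'.
Proof.
move=> He Hm Hb Hb' S T T' Ew Eb; case: b b' Hb Hb' S T T' Eb.
move=> u g β [u' g' β'] /= Hb Hb' S T T' Eb; subst u' g g'.
have iβ : invertible β by apply/invertible_invT; exists c.
have iβ' : invertible β' by apply/invertible_invT; exists c'.
pose φ := recast (β ▹ e) eq_refl (comp1A' m w e).
have iφ : invertible φ by apply/recast_invertible/whisker_r_invertible.
have [w0 [φ0 [_ [U _]]]] := EFS_fill hEM He Hm iφ.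
have Hφ : β ▹ e ≡ φ by apply/same_sym/recast_same.
have Hφ' : β' ▹ e ≡ φ by apply: same_trans Hφ; apply/Tot_same/esym.
have [E1 /TotP E2] := U w β (conj iβ (conj eq_refl Hφ)).
have [E1' /TotP E2'] := U w' β' (conj iβ' (conj (esym Ew) Hφ')).
by split; [rewrite E1 E1' | apply: etrans E2 (esym E2')].
Qed.

(** The variant for cells that end, rather than start, at the common 1-cell; it follows by passing
    to inverses. *)
Lemma fillT_uniq_inv (A X B Y : K) (e : hom A X) (m : hom B Y)
    (w w' : hom X B) (b c b' c' : Arrow X Y) : E e -> M m ->
    invT b c -> invT b' c' -> tgt b = tgt b' ->
    src b = m ∘ w -> src b' = m ∘ w' -> w ∘ e = w' ∘ e -> b ⊛ e = b' ⊛ e ->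
  w = w' /\ b = b'.
Proof.
move=> He Hm Hb Hb' T S S' Ew Eb.
have Ec : c ⊛ e = c' ⊛ e.
  by apply: invT_uniq (invT_hr e Hb) _; rewrite Eb; apply: invT_hr.
have [C1 C2 _ _] := Hb; have [C1' C2' _ _] := Hb'.
have [-> Ecc] : w = w' /\ c = c'.
  apply: (fillT_uniq He Hm (invTC Hb) (invTC Hb')) => //.
  - by rewrite C1 C1'.
  - by rewrite C2.
  - by rewrite C2'.
split=> //; apply: invT_uniq (invTC Hb) _; rewrite Ecc; exact: invTC.
Qed.

End Factorization.

Definition retr_equiv (K : TwoCat) (I X : K) (m : hom I X) (n : hom X I)
    (α α' : Arrow I I) : Prop :=
  [/\ m ∘ n = id1 X, invT α α', src α = id1 I & tgt α = n ∘ m].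

Section RetractEquivalence.
Variables (K : TwoCat) (I X : K) (m : hom I X) (n : hom X I).
Variables (α α' : Arrow I I).
Hypothesis H : retr_equiv m n α α'.

(** By naturality, [c] followed by [α] is [α] followed by [n m c]; since [α] is invertible, [m c]
    and the boundary of [c] determine [c]. *)
Lemma retr_faithful (Z : K) (a b : Arrow Z I) :
  src a = src b -> tgt a = tgt b -> m ⊛ a = m ⊛ b -> a = b.
Proof.
have [mn iα sα tα] := H => Es Et E.
apply: (invT_cancel_r (invT_hr (tgt a) iα)); rewrite /= ?sα ?id1_l //.
have D (c : Arrow Z I) : c ⨟ (α ⊛ tgt c) = (α ⊛ src c) ⨟ (n ⊛ (m ⊛ c)).
  by rewrite -hTMl -tα slide_r -(slide_l α c) sα hT1l.
by rewrite {2}Et !D E Es.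
Qed.

Lemma retr_cofaithful (Z : K) (a b : Arrow I Z) :
  src a = src b -> tgt a = tgt b -> a ⊛ n = b ⊛ n -> a = b.
Proof.
have [mn iα sα tα] := H => Es Et E.
apply: (invT_cancel_r (invT_hl (tgt a) iα)); rewrite /= ?sα ?id1_r //.
have D (c : Arrow I Z) : c ⨟ (tgt c ⊛ α) = (src c ⊛ α) ⨟ (c ⊛ n ⊛ m).
  by rewrite -hTMr -tα slide_l -(slide_r c α) sα hT1r.
by rewrite {2}Et !D E Es.
Qed.

End RetractEquivalence.

Lemma retr_equiv_adjoint (K : TwoCat) (I X : K) (m : hom I X) (n : hom X I) :
  m ∘ n = id1 X -> isomorphic (n ∘ m) (id1 I) ->
  exists α α' : Arrow I I,
    [/\ retr_equiv m n α α', m ⊛ α = m & α ⊛ n = n].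
Proof.
move=> mn [γ /invertible_invT [β Hγ]].
have [B1 B2 B3 B4] := Hγ; rewrite /= in B1 B2 B3 B4.
(* the usual correction of an equivalence to an adjoint equivalence *)
set α := β ⨟ (n ∘ m ⊛ Tot γ).
have tα : tgt β = src (n ∘ m ⊛ Tot γ).
  by rewrite /= B2 comp1A -(comp1A n) mn id1_r.
have [α' iα] : exists α', invT α α'.
  by eexists; apply: invT_v => //; [apply: invTC Hγ | apply: invT_hl Hγ].
have R : retr_equiv m n α α'.
  split=> //; first by rewrite /α src_vT B1.
  by rewrite /α tgt_vT //= id1_r.
(* As [m n = id], whiskering with [m] leaves [m β] followed by [m γ], and these cancel. *)
have mα : m ⊛ α = m.
  rewrite /α hTvl // -hTMl comp1A mn id1_l -hTvl; last exact: B2.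
  by rewrite B4 hT1 id1_r.
exists α, α'; split=> //; have [_ _ sα tα'] := R.
(* The equation for [α n] is tested after [m], where it follows from [m α = m]. *)
apply: (retr_faithful R); rewrite /= ?sα ?tα' ?id1_l // -?comp1A ?mn ?id1_r //.
by rewrite hTA mα.
Qed.

(** * Pseudoalgebras *)

Section AlgebrasT.
Variables (K : TwoCat) (T : TwoMonad K).
Local Notation ι := (mι T).
Local Notation μ := (mμ T).
Local Notation T1 f := (fmap T f).
Local Notation TT a := (mapT T a).
Implicit Types X Y Z : PsAlgebra T.

Lemma passoc_unit_lT X : Tot (passoc X) ⊛ ι (T X) = pact X.
Proof.
have /is_identityT := passoc_unit_l X; rewrite -[Tot (_ ▹ _)]/(Tot _ ⊛ ι _).
by move=> ->; rewrite -comp1A nat_ι comp1A pact_unit id1_l.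
Qed.

Lemma passoc_unit_rT X : Tot (passoc X) ⊛ T1 (ι X) = pact X.
Proof.
have /is_identityT := passoc_unit_r X; rewrite -[Tot (_ ▹ _)]/(Tot _ ⊛ T1 (ι _)).
by move=> ->; rewrite -comp1A -fmap_comp pact_unit fmap_id id1_r.
Qed.

Lemma passoc_cohT X :
  (Tot (passoc X) ⊛ T1 (T1 (pact X))) ⨟ (Tot (passoc X) ⊛ μ (T X)) =
  (pact X ⊛ TT (Tot (passoc X))) ⨟ (Tot (passoc X) ⊛ T1 (μ X)).
Proof. by move: (TotP (passoc_coh X)); rewrite !vT_along. Qed.

Lemma pcell_unitT X Y (p : PsHom X Y) : Tot (pcell p) ⊛ ι X = phom p.
Proof. exact: TotP (pcell_unit p). Qed.

Lemma pcell_cohT X Y (p : PsHom X Y) :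
  (pact Y ⊛ TT (Tot (pcell p))) ⨟ (Tot (pcell p) ⊛ T1 (pact X))
    ⨟ (phom p ⊛ Tot (passoc X)) =
  (Tot (passoc Y) ⊛ T1 (T1 (phom p))) ⨟ (Tot (pcell p) ⊛ μ X).
Proof. by move: (TotP (pcell_coh p)); rewrite !vT_along. Qed.

Lemma ps_comp_cellT X Y Z (q : PsHom Y Z) (p : PsHom X Y) :
  Tot (pcell (ps_comp q p)) =
  (Tot (pcell q) ⊛ T1 (phom p)) ⨟ (phom q ⊛ Tot (pcell p)).
Proof. by rewrite (TotP (ps_comp_cellE q p)) vT_along. Qed.

Lemma PsHom_eqT X Y (p q : PsHom X Y) :
  phom p = phom q -> Tot (pcell p) = Tot (pcell q) -> p = q.
Proof. by move=> E /Tot_same; apply: PsHom_eq. Qed.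

Lemma passoc_st (Z : StAlgebra T) :
  Tot (passoc (st_ps Z)) = sact Z ∘ T1 (sact Z).
Proof. exact: Tot_eqcell. Qed.

Lemma is_alg_cellT X Y (f g : PsHom X Y) (λ : cell (phom f) (phom g)) :
  is_alg_cell λ <->
  (pact Y ⊛ TT (Tot λ)) ⨟ Tot (pcell g) = Tot (pcell f) ⨟ (Tot λ ⊛ pact X).
Proof.
rewrite -[pact Y ⊛ _]/(Tot (pact Y ◃ fmap2 T λ)).
rewrite -[Tot λ ⊛ _]/(Tot (λ ▹ pact X)) -!vT_vcomp.
by split=> [->|/Tot_inj].
Qed.

Lemma is_alg_cell_inv X Y (f g : PsHom X Y) (λ : cell (phom f) (phom g))
    (λ' : cell (phom g) (phom f)) :
  is_alg_cell λ -> vcomp λ λ' = id2 _ -> vcomp λ' λ = id2 _ ->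
  @is_alg_cell K T X Y g f λ'.
Proof.
rewrite /is_alg_cell => law H H'.
rewrite -[LHS]vcomp_id_r -hcomp_id2 -H whisker_r_vcomp.
rewrite [LHS]vcompA -(vcompA (_ ◃ _)) -law vcompA.
by rewrite -whisker_l_vcomp -fmap2_vcomp H' fmap2_id hcomp_id2 vcomp_id_l.
Qed.

(** * Pseudomorphisms and strict maps from packed data *)

Section Build.
Variables (X Y : PsAlgebra T) (f : hom X Y) (a : Arrow (T X) Y).
Hypotheses (sa : pact Y ∘ T1 f = src a) (ta : tgt a = f ∘ pact X).
Hypothesis ia : exists a', invT a a'.
Hypothesis ua : a ⊛ ι X = f.
Hypothesis ca :
  (pact Y ⊛ TT a) ⨟ (a ⊛ T1 (pact X)) ⨟ (f ⊛ Tot (passoc X)) =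
  (Tot (passoc Y) ⊛ T1 (T1 f)) ⨟ (a ⊛ μ X).

Lemma build_inv : invertible (castT sa ta).
Proof. by apply/invertible_invT; rewrite Tot_castT. Qed.

Lemma build_unit : castT sa ta ▹ ι X ≡ id2 f.
Proof.
by apply: Tot_same; rewrite -[Tot (_ ▹ _)]/(Tot _ ⊛ ι X) Tot_castT.
Qed.

Lemma build_coh :
  (pact Y ◃ fmap2 T (castT sa ta))
    ⨾[act_comp (pact Y) f (pact X)] (castT sa ta ▹ T1 (pact X))
    ⨾[comp1A' f (pact X) (T1 (pact X))] (f ◃ passoc X) ≡
  (passoc Y ▹ T1 (T1 f))
    ⨾[act_nat_μ (pact Y) f] (castT sa ta ▹ μ X).
Proof.
apply: Tot_same; rewrite !vT_along -[Tot (castT _ _ ▹ μ X)]/(Tot _ ⊛ μ X).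
rewrite -[Tot (_ ▹ T1 (pact X))]/(Tot _ ⊛ T1 (pact X)).
rewrite -[Tot (pact Y ◃ _)]/(pact Y ⊛ TT (Tot _)) Tot_castT.
exact: ca.
Qed.

Definition build_PsHom : PsHom X Y :=
  @Build_PsHom K T X Y f (castT sa ta) build_inv build_unit build_coh.

Lemma build_PsHom_cell : Tot (pcell build_PsHom) = a.
Proof. exact: Tot_castT. Qed.
End Build.

Section BuildStrict.
Variables (Y Z : StAlgebra T) (g : hom Y Z).
Hypothesis hg : sact Z ∘ T1 g = g ∘ sact Y.

Lemma build_st_unit : (g ∘ sact Y) ⊛ ι Y = g.
Proof. by rewrite hT1 -comp1A sact_unit id1_r. Qed.

Lemma build_st_coh :
  (sact Z ⊛ TT (g ∘ sact Y)) ⨟ ((g ∘ sact Y) ⊛ T1 (sact Y))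
    ⨟ (g ⊛ Tot (passoc (st_ps Y))) =
  (Tot (passoc (st_ps Z)) ⊛ T1 (T1 g)) ⨟ ((g ∘ sact Y) ⊛ μ Y).
Proof.
have E1 : sact Z ∘ T1 (g ∘ sact Y) = g ∘ sact Y ∘ T1 (sact Y).
  by rewrite fmap_comp comp1A hg.
have E2 : sact Z ∘ T1 (sact Z) ∘ T1 (T1 g) = g ∘ sact Y ∘ T1 (sact Y).
  by rewrite -E1 -hg fmap_comp comp1A.
rewrite !passoc_st mapT1 !hT1 E1 E2 comp1A -(comp1A g _ (μ _)) -sact_assoc.
by rewrite comp1A !vT1l.
Qed.

Definition build_st : PsHom (st_ps Y) (st_ps Z) :=
  @build_PsHom (st_ps Y) (st_ps Z) g (g ∘ sact Y) hg eq_refl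
    (ex_intro _ _ (invT1 _)) build_st_unit build_st_coh.

Lemma build_st_strict : is_strict build_st.
Proof. by apply: (is_identityT (pcell build_st)).2; rewrite build_PsHom_cell /= hg. Qed.

Definition build_StHom : StHom Y Z := exist _ build_st build_st_strict.
End BuildStrict.

Lemma strict_cell (Y Z : StAlgebra T) (g : StHom Y Z) :
  Tot (pcell (proj1_sig g)) = sact Z ∘ T1 (phom (proj1_sig g)).
Proof. by case: g => g Hg; rewrite ((is_identityT (pcell g)).1 Hg). Qed.

Lemma strict_hom (Y Z : StAlgebra T) (g : StHom Y Z) :
  sact Z ∘ T1 (phom (proj1_sig g)) = phom (proj1_sig g) ∘ sact Y.
Proof. exact: esym (congr1 (@tgt _ _ _) (strict_cell g)). Qed.

End AlgebrasT.

(** * The strictification of a pseudoalgebra *)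

Section Strictification.
Variables (K : TwoCat) (E M : cell1_class K) (T : TwoMonad K).
Hypotheses (hEM : is_EFS E M) (hT : preserves_class T E).
Local Notation ι := (mι T).
Local Notation μ := (mμ T).
Local Notation T1 f := (fmap T f).
Local Notation TT a := (mapT T a).
Variables (X : PsAlgebra T) (I : K) (e : hom (T X) I) (m : hom I X).
Local Notation θ := (pact X).
Local Notation φ := (Tot (passoc X)).
Hypotheses (He : E e) (Hm : M m) (me : m ∘ e = θ).
Variables (ξ : hom (T I) I) (ψ ψ' : Arrow (T I) X).
Hypotheses (iψ : invT ψ ψ') (sψ : src ψ = θ ∘ T1 m) (tψ : tgt ψ = m ∘ ξ).
Hypotheses (ξe : ξ ∘ T1 e = e ∘ μ X) (ψe : ψ ⊛ T1 e = φ).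

(** Both [(ξ ι, ψ ι)] and [(id, m)] fill [e] against [m]: along [e], naturality of [ι] turns [ψ ι e]
    into [ψ (T e) ι = φ ι], trivial by normality. *)
Lemma image_unit : ξ ∘ ι I = id1 I /\ ψ ⊛ ι I = m.
Proof.
apply: (fillT_uniq hEM He Hm (invT_hr (ι I) iψ) (invT1 m)).
- by rewrite /= sψ -comp1A nat_ι comp1A pact_unit id1_l.
- by rewrite /= tψ comp1A.
- by rewrite /= id1_r.
- by rewrite -comp1A -nat_ι comp1A ξe -comp1A monad_unit_l id1_r id1_l.
- by rewrite -(hTMr ψ) -nat_ι hTMr ψe passoc_unit_lT hT1 me.
Qed.

(** Uniqueness of fillers for [T (T e)], which is in [E], against [m]: along it the two pasted cells
    become the two sides of the coherence of [φ]. The first half is the associativity of [ξ], the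
    second the coherence of [(m, ψ)]. *)
Lemma image_assoc : ξ ∘ T1 ξ = ξ ∘ μ I /\
  (θ ⊛ TT ψ) ⨟ (ψ ⊛ T1 ξ) = (φ ⊛ T1 (T1 m)) ⨟ (ψ ⊛ μ I).
Proof.
have [φ' iφ] := (invertible_invT (passoc X)).1 (passoc_inv X).
have E1 : tgt (θ ⊛ TT ψ) = src (ψ ⊛ T1 ξ).
  by rewrite /= sψ tψ fmap_comp comp1A.
have E2 : tgt (φ ⊛ T1 (T1 m)) = src (ψ ⊛ μ I).
  by rewrite /= sψ -!comp1A nat_μ.
apply: (fillT_uniq hEM (hT (hT He)) Hm
  (invT_v E1 (invT_hl θ (mapT_inv T iψ)) (invT_hr _ iψ))
  (invT_v E2 (invT_hr _ iφ) (invT_hr _ iψ))).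
- by rewrite !src_vT /= sψ fmap_comp comp1A.
- by rewrite tgt_vT // /= tψ comp1A.
- by rewrite tgt_vT // /= tψ comp1A.
- rewrite -[LHS]comp1A -[RHS]comp1A -fmap_comp ξe nat_μ [RHS]comp1A fmap_comp.
  by rewrite comp1A ξe -!comp1A monad_assoc.
- rewrite !hTvr //.
  rewrite -[θ ⊛ _ ⊛ _]hTA -mapThr ψe.
  rewrite -(hTMr ψ) -fmap_comp ξe fmap_comp hTMr ψe.
  rewrite -(hTMr φ) -!fmap_comp me.
  rewrite -(hTMr ψ) nat_μ hTMr ψe.
  by rewrite passoc_cohT.
Qed.

Definition image_alg : StAlgebra T :=
  @Build_StAlgebra K T I ξ image_unit.1 image_assoc.1.
Local Notation A := image_alg.

Lemma image_incl_unit : ψ ⊛ ι A = m.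
Proof. exact: image_unit.2. Qed.

Lemma image_incl_coh :
  (pact X ⊛ TT ψ) ⨟ (ψ ⊛ T1 (pact (st_ps A))) ⨟ (m ⊛ Tot (passoc (st_ps A))) =
  (Tot (passoc X) ⊛ T1 (T1 m)) ⨟ (ψ ⊛ μ A).
Proof.
rewrite -image_assoc.2 passoc_st hT1 vT1r //.
by rewrite tgt_vT /= ?sψ tψ ?comp1A // fmap_comp comp1A.
Qed.

Definition image_incl : PsHom (st_ps A) X :=
  @build_PsHom K T (st_ps A) X m ψ (esym sψ) tψ (ex_intro _ _ iψ)
    image_incl_unit image_incl_coh.

(** * The unit pseudomorphism into the image *)

Variable n : hom X I.
Hypothesis nE : n = e ∘ ι X.

Lemma image_retr : m ∘ n = id1 X.
Proof. by rewrite nE comp1A me pact_unit. Qed.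

Lemma image_act_unit : ξ ∘ T1 n = e.
Proof. by rewrite nE fmap_comp comp1A ξe -comp1A monad_unit_r id1_r. Qed.

Variables α α' : Arrow I I.
Hypotheses (R : retr_equiv m n α α') (mα : m ⊛ α = m) (αn : α ⊛ n = n).

Let iα : invT α α'. Proof. by have [] := R. Qed.
Let sα : src α = id1 I. Proof. by have [] := R. Qed.
Let tα : tgt α = n ∘ m. Proof. by have [] := R. Qed.

Lemma image_key_tgt : tgt (m ∘ ξ ⊛ TT α) = src ψ.
Proof. by rewrite /= sψ tα fmap_comp comp1A -(comp1A m) image_act_unit me. Qed.

(* Sliding [ψ] past [T α] leaves [m α], which is trivial, and
   [ψ (T n) = φ (T ι)], which is trivial by the unit law. *)
Lemma image_key : (m ∘ ξ ⊛ TT α) ⨟ ψ = m ∘ ξ.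
Proof.
have H1 : ψ ⨟ (m ∘ ξ ⊛ TT α) = src ψ.
  have := slide_r ψ (TT α); rewrite -(slide_l ψ (TT α)) /= tψ sψ sα fmap_id.
  rewrite hT1r => ->; rewrite tα hTMl -mapThl mα mapT1 hT1.
  rewrite vT1l.
    rewrite fmap_comp hTMr nE fmap_comp hTMr ψe passoc_unit_rT hT1.
    by rewrite ?comp1A.
  by rewrite /= sψ -comp1A -fmap_comp comp1A image_retr id1_l.
(* A right inverse of the invertible cell [ψ] is also a left inverse. *)
rewrite -{2}tψ; apply: (invT_swap iψ) => //=.
  by rewrite tψ sα fmap_id id1_r.
exact: image_key_tgt.
Qed.

Lemma image_unit_src : ξ ∘ T1 n = src (α ⊛ e).
Proof. by rewrite /= sα id1_l image_act_unit. Qed.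

Lemma image_unit_tgt : tgt (α ⊛ e) = n ∘ θ.
Proof. by rewrite /= tα -comp1A me. Qed.

Lemma image_unit_unit : (α ⊛ e) ⊛ ι X = n.
Proof. by rewrite -hTMr -nE. Qed.

(** Tested after [m]: since [m α] is trivial and [m n = id], the left side becomes [m ξ T(α e)]
    followed by [φ = ψ (T e)], which is [image_key] whiskered with [T e]; the right side becomes an
    identity. *)
Lemma image_unit_coh :
  (ξ ⊛ TT (α ⊛ e)) ⨟ (α ⊛ e ⊛ T1 θ) ⨟ (n ⊛ φ) =
  (Tot (passoc (st_ps A)) ⊛ T1 (T1 n)) ⨟ (α ⊛ e ⊛ μ X).
Proof.
have E1 : tgt (ξ ⊛ TT (α ⊛ e)) = src (α ⊛ e ⊛ T1 θ).
  by rewrite /= sα tα id1_l -comp1A me fmap_comp comp1A image_act_unit.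
have E2 : tgt ((ξ ⊛ TT (α ⊛ e)) ⨟ (α ⊛ e ⊛ T1 θ)) = src (n ⊛ φ).
  by rewrite tgt_vT //= tα -!comp1A (comp1A m) me.
have E3 : ξ ∘ T1 ξ ∘ T1 (T1 n) = e ∘ μ X.
  by rewrite -comp1A -fmap_comp image_act_unit ξe.
have E4 : tgt (Tot (passoc (st_ps A)) ⊛ T1 (T1 n)) = src (α ⊛ e ⊛ μ X).
  by rewrite passoc_st /= E3 sα id1_l.
apply: (retr_faithful R).
- by rewrite !src_vT passoc_st /= E3 sα id1_l ξe.
- by rewrite !tgt_vT //= tα -!comp1A (comp1A m) me.
rewrite !hTvl // passoc_st hT1 E3 -[α ⊛ e ⊛ _]hTA (hTA m α) mα.
rewrite -[α ⊛ e ⊛ _]hTA (hTA m α) mα -(hTMl m n) image_retr hT1l.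
rewrite !hT1 [RHS]vT1l // mapThr !hTA hT1 vT1r.
  by rewrite -ψe -hTvr ?image_key_tgt // image_key hT1 -comp1A ξe.
by rewrite -[LHS]/(tgt (m ∘ ξ ⊛ TT α) ∘ T1 e) image_key_tgt sψ -comp1A
  -fmap_comp me -me comp1A.
Qed.

Lemma image_unit_inv : exists a', invT (α ⊛ e) a'.
Proof. by exists (α' ⊛ e); apply: invT_hr. Qed.

Definition image_hom : PsHom X (st_ps A) :=
  @build_PsHom K T X (st_ps A) n (α ⊛ e) image_unit_src image_unit_tgt
    image_unit_inv image_unit_unit image_unit_coh.
Local Notation η := image_hom.

Lemma image_hom_cell : Tot (pcell η) = α ⊛ e.
Proof. exact: build_PsHom_cell. Qed.

Lemma strict_comp_cell (Z : StAlgebra T) (g : StHom A Z) :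
  Tot (pcell (ps_comp (proj1_sig g) η)) = phom (proj1_sig g) ⊛ α ⊛ e.
Proof.
rewrite ps_comp_cellT strict_cell image_hom_cell hT1 -hTA vT1l //=.
rewrite sα id1_l; have /= -> := strict_hom g.
by rewrite -comp1A image_act_unit.
Qed.

(** Because [ξ (T n) = e], a strict map is determined along [e] by its restriction along [n]; this
    feeds the uniqueness of fillers. *)
Lemma strict_comp_hom (Z : StAlgebra T) (g : StHom A Z) :
  phom (proj1_sig g) ∘ e =
  sact Z ∘ T1 (phom (proj1_sig g) ∘ n).
Proof.
rewrite fmap_comp comp1A; have /= -> := strict_hom g.
by rewrite -comp1A image_act_unit.
Qed.

(** The cells [g α] and [g' α] share the target [g n m = g' n m] and agree along [e], where they are
    the cells of the two composites. Uniqueness of fillers of [e] against [id1 Z] then gives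
    [g = g']. *)
Lemma image_hom_epi (Z : StAlgebra T) (g g' : StHom A Z) :
  ps_comp (proj1_sig g) η = ps_comp (proj1_sig g') η -> g = g'.
Proof.
move=> Eg; have En : phom (proj1_sig g) ∘ n = phom (proj1_sig g') ∘ n.
  exact: (congr1 (@phom _ _ _ _) Eg).
have Ec : phom (proj1_sig g) ⊛ α ⊛ e = phom (proj1_sig g') ⊛ α ⊛ e.
  by rewrite -!strict_comp_cell Eg.
have M1 := M_id hEM Z.
have [Egg _] : phom (proj1_sig g) = phom (proj1_sig g') /\
    phom (proj1_sig g) ⊛ α = phom (proj1_sig g') ⊛ α.
  apply: (fillT_uniq_inv hEM He M1 (invT_hl _ iα) (invT_hl _ iα)) => //.
  - by rewrite /= tα !(comp1A _ n m) En.
  - by rewrite /= sα id1_l id1_r.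
  - by rewrite /= sα id1_l id1_r.
  - by rewrite !strict_comp_hom En.
by apply/StHom_eq/PsHom_eqT; rewrite // !strict_cell Egg.
Qed.

(** * Existence of strict extensions *)

Section Extension.
Variables (Z : StAlgebra T) (p : PsHom X (st_ps Z)).
Local Notation f := (phom p).
Local Notation κ := (Tot (pcell p)).
Local Notation ζ := (sact Z).

Lemma extension_fill : exists (g : hom I Z) (χ χ' : Arrow I Z),
  [/\ invT χ χ', src χ = g, tgt χ = f ∘ m, g ∘ e = ζ ∘ T1 f & χ ⊛ e = κ].
Proof.
have M1 := M_id hEM Z.
have [κ' iκ] := (invertible_invT (pcell p)).1 (pcell_inv p).
have [K1 K2 _ _] := iκ.
have S : src κ' = (f ∘ m) ∘ e by rewrite K1 /= -comp1A me.
have T' : tgt κ' = id1 Z ∘ (ζ ∘ T1 f) by rewrite K2 /= id1_l.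
(* A filler cell starts at the given 1-cell, here [f ∘ m], so the inverse of [κ] is filled and the
   result inverted afterwards. *)
have [g [χ [χ' [iχ s t ge χe]]]] := fillT hEM He M1 (invTC iκ) S T'.
have [C1 C2 _ _] := iχ; exists g, χ', χ; split=> //.
- exact: invTC.
- by rewrite C1 t id1_l.
- by rewrite C2.
by apply: invT_uniq (invT_hr e iχ) _; rewrite χe; apply: invTC.
Qed.

Lemma extension_ex : exists g : StHom A Z, ps_comp (proj1_sig g) η = p.
Proof.
have [g [χ [χ' [iχ s t ge χe]]]] := extension_fill.
have M1 := M_id hEM Z.
have gn : g ∘ n = f.
  by rewrite nE comp1A ge -comp1A nat_ι comp1A sact_unit id1_l.
(* both sides restrict to the identity along [n] *)
have gα : g ⊛ α = χ.
  apply: (retr_cofaithful R).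
  - by rewrite /= sα id1_r.
  - by rewrite /= tα comp1A gn.
  - by rewrite -hTA αn hT1 gn nE hTMr χe; apply: esym (pcell_unitT p).
have E1 : tgt (ζ ⊛ TT χ) = src (κ ⊛ T1 m).
  by rewrite /= t fmap_comp comp1A.
have E2 : tgt ((ζ ⊛ TT χ) ⨟ (κ ⊛ T1 m)) = src (f ⊛ ψ).
  by rewrite tgt_vT //= sψ comp1A.
have [κ' iκ] := (invertible_invT (pcell p)).1 (pcell_inv p).
(* both 1-cells fill one square, the cells agreeing by the coherence of [p] *)
have [hg _] : ζ ∘ T1 g = g ∘ ξ /\
    (ζ ⊛ TT χ) ⨟ (κ ⊛ T1 m) ⨟ (f ⊛ ψ) = χ ⊛ ξ.
  apply: (fillT_uniq_inv hEM (hT He) M1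
    (invT_v E2 (invT_v E1 (invT_hl _ (mapT_inv T iχ)) (invT_hr _ iκ))
      (invT_hl f iψ)) (invT_hr ξ iχ)).
  - by rewrite tgt_vT //= t tψ comp1A.
  - by rewrite !src_vT /= s id1_l.
  - by rewrite /= s id1_l.
  - rewrite -!comp1A -fmap_comp ge ξe comp1A ge fmap_comp comp1A sact_assoc.
    by rewrite -!comp1A nat_μ.
  - rewrite !hTvr // -!(hTMr κ) -!fmap_comp me -[f ⊛ _ ⊛ _]hTA ψe.
    rewrite -[ζ ⊛ _ ⊛ _]hTA -mapThr χe -(hTMr χ) ξe hTMr χe.
    have := pcell_cohT p => /= ->; rewrite passoc_st hT1 vT1l //=.
    by rewrite sact_assoc -!comp1A nat_μ.
exists (@build_StHom K T A Z g hg); apply: PsHom_eqT => //.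
(* The composite has cell [g α e = χ e = κ]. *)
by rewrite strict_comp_cell /= gα.
Qed.
End Extension.

(** Allows equations between cells out of [T I] to be tested along [T n]. *)
Lemma fmap_retr_equiv : retr_equiv (T1 m) (T1 n) (TT α) (TT α').
Proof.
split; rewrite /= ?sα ?tα ?fmap_id ?fmap_comp //; last exact: mapT_inv.
by rewrite -fmap_comp image_retr fmap_id.
Qed.

Lemma retr_inv_unit : α' ⊛ n = n.
Proof. by apply: invT_uniq (invT_hr n iα) _; rewrite αn; apply: invT1. Qed.

(** * The universal property on 2-cells *)

Section Extension2.
Variables (Z : StAlgebra T) (g g' : StHom A Z).
Variable λ : PsCell (ps_comp (proj1_sig g) η) (ps_comp (proj1_sig g') η).
Local Notation f := (phom (proj1_sig g)).
Local Notation f' := (phom (proj1_sig g')).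
Local Notation l := (Tot (proj1_sig λ)).
Local Notation ζ := (sact Z).

Lemma extension2_ex : exists ρ : PsCell (proj1_sig g) (proj1_sig g'),
  ps_hcomp ρ (ps_id2 η) = λ.
Proof.
have [A1 A2 A3 A4] := iα; rewrite sα in A2; rewrite tα in A1.
(* the only candidate: [α] conjugates [l m] into a cell from [f] to [f'] *)
pose r := (f ⊛ α) ⨟ (l ⊛ m) ⨟ (f' ⊛ α').
have E1 : tgt (f ⊛ α) = src (l ⊛ m) by rewrite /= tα comp1A.
have E2 : tgt ((f ⊛ α) ⨟ (l ⊛ m)) = src (f' ⊛ α').
  by rewrite tgt_vT //= A1 comp1A.
have sr : f = src r by rewrite !src_vT /= sα id1_r.
have tr : tgt r = f' by rewrite tgt_vT //= A2 id1_r.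
have rn : r ⊛ n = l.
  rewrite /r !hTvr // -[f ⊛ _ ⊛ _]hTA αn -[f' ⊛ _ ⊛ _]hTA retr_inv_unit.
  by rewrite -[l ⊛ _ ⊛ _]hTA !hT1 image_retr hT1r vT1l ?vT1r.
(* The algebra law of [λ] exchanges [f α e] followed by [l θ] for [ζ (T l)] followed by [f' α e],
   and the last factor cancels against [f' α' e]. *)
have re : r ⊛ e = ζ ⊛ TT l.
  have := (is_alg_cellT (proj1_sig λ)).1 (proj2_sig λ).
  rewrite !strict_comp_cell /= => law.
  rewrite /r !hTvr // -(hTMr l) me -law.
  have E3 : tgt (f' ⊛ α ⊛ e) = src (f' ⊛ α' ⊛ e) by rewrite /= tα A1.
  have E4 : tgt (ζ ⊛ TT l) = src (f' ⊛ α ⊛ e).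
    by rewrite /= sα id1_r strict_comp_hom.
  rewrite -vTA // -hTvr /= ?tα ?A1 // -hTvl ?tα ?A1 // A3 sα hT1r hT1 vT1r //=.
  by rewrite strict_comp_hom.
have alg : is_alg_cell (castT sr tr).
  apply/is_alg_cellT; rewrite Tot_castT !strict_cell vT1r ?vT1l /= ?tr -?sr //.
    (* The cells of [g] and [g'] are identities, so the law reads [ζ (T r) = r ξ]; along [T n] it
       becomes [ζ (T l) = r e]. *)
    apply: (retr_cofaithful fmap_retr_equiv).
    - by rewrite /= -sr; have /= -> := strict_hom g.
    - by rewrite /= tr; have /= -> := strict_hom g'.
    - by rewrite -hTA -mapThr rn -hTMr image_act_unit re.
  by have /= -> := strict_hom g.
exists (exist _ _ alg); apply: PsCell_eq; apply: Tot_inj => /=.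
by rewrite -[LHS]/(Tot _ ⊛ n) Tot_castT.
Qed.

Lemma extension2_uniq (ρ ρ' : PsCell (proj1_sig g) (proj1_sig g')) :
  ps_hcomp ρ (ps_id2 η) = λ -> ps_hcomp ρ' (ps_id2 η) = λ -> ρ = ρ'.
Proof.
move=> <- /(congr1 (@proj1_sig _ _)) /= E'; apply/PsCell_eq/Tot_inj.
by apply: (retr_cofaithful R); rewrite //; exact: (congr1 Tot (esym E')).
Qed.
End Extension2.

Lemma image_hom_universal :
  @is_universal_arrow (PsAlg T) (AlgSt T) (inclusion T) X A η.
Proof.
split=> [Z p | Z g g' λ].
  have [g Hg] := extension_ex p; exists g; split=> // g' Hg'.
  by apply: image_hom_epi; rewrite Hg -Hg'.
have [ρ Hρ] := extension2_ex λ; exists ρ; split=> // ρ' Hρ'.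
exact: extension2_uniq Hρ Hρ'.
Qed.

(** * The unit as an internal equivalence *)

Lemma image_incl_retr : ps_comp image_incl η = ps_id X.
Proof.
apply: PsHom_eqT; first exact: image_retr.
rewrite ps_comp_cellT image_hom_cell build_PsHom_cell Tot_eqcell /=.
(* Both factors are identities: [ψ (T n) = φ (T ι)] by normality and [m α e] by the choice of
   [α]. *)
rewrite nE fmap_comp hTMr ψe passoc_unit_rT hTA mα hT1 me vT1l //.
by rewrite fmap_id id1_r.
Qed.

(** Tested after [m], where the left side reduces to [image_key] and the right side [m α ξ] is
    trivial. *)
Lemma image_equiv_law :
  @is_alg_cell K T (st_ps A) (st_ps A) (ps_id _) (ps_comp η image_incl)
    (castT (esym sα) tα).
Proof.
apply/is_alg_cellT; rewrite Tot_castT ps_comp_cellT image_hom_cell.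
rewrite build_PsHom_cell Tot_eqcell /=.
have E1 : tgt (ξ ⊛ TT α) = src (α ⊛ e ⊛ T1 m).
  by rewrite /= tα sα id1_l fmap_comp comp1A image_act_unit.
have E2 : tgt (α ⊛ e ⊛ T1 m) = src (n ⊛ ψ).
  by rewrite /= tα sψ -!comp1A (comp1A m e) me.
have E3 : tgt (ξ ⊛ TT α) = src ((α ⊛ e ⊛ T1 m) ⨟ (n ⊛ ψ)).
  by rewrite src_vT.
rewrite [RHS]vT1l; last by rewrite /= sα fmap_id id1_l id1_r.
apply: (retr_faithful R).
- by rewrite src_vT /= sα fmap_id id1_l id1_r.
- by rewrite !tgt_vT //= tψ tα comp1A.
rewrite !hTvl // -(hTMl m ξ) -(hTMl m n) image_retr hT1l (hTA m (α ⊛ e)).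
rewrite !(hTA m α) mα !hT1 (vT1l (a := ψ)) ?image_key //.
by rewrite sψ me.
Qed.

Lemma image_hom_equivalence :
  @is_internal_equivalence (PsAlg T) X (st_ps A) η.
Proof.
have [A1 A2 A3 A4] := iα; rewrite sα in A2 A3; rewrite tα in A1 A4.
pose a := castT (esym sα) tα.
pose b := castT (esym A1) A2.
have ab : vcomp a b = id2 (id1 I).
  by apply: Tot_inj; rewrite vT_vcomp !Tot_castT.
have ba : vcomp b a = id2 (n ∘ m).
  by apply: Tot_inj; rewrite vT_vcomp !Tot_castT.
(* The second cell of an equivalence must end at the identity, so the inverse of [α] is the one
   supplied; the first is an identity by [image_incl_retr]. *)
have law := is_alg_cell_inv image_equiv_law ab ba.
exists image_incl, (@eqcell (PsAlg T) _ _ _ _ (esym image_incl_retr)).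
exists (exist _ _ law); split; first exact: eqcell_invertible.
by exists (exist _ _ image_equiv_law); split; apply: PsCell_eq.
Qed.

End Strictification.

(** * Assembling the strictifications into a left adjoint *)

Lemma strictification_ex (K : TwoCat) (E M : cell1_class K) (T : TwoMonad K)
    (hEM : is_rigid_EFS E M) (hT : preserves_class T E) (X : PsAlgebra T) :
  exists (A : StAlgebra T) (η : PsHom X (st_ps A)),
    @is_universal_arrow (PsAlg T) (AlgSt T) (inclusion T) X A η /\
    @is_internal_equivalence (PsAlg T) X (st_ps A) η.
Proof.
have [I [e [m [He [Hm me]]]]] := EFS_factor hEM (pact X).
have [φ' iφ] := (invertible_invT (passoc X)).1 (passoc_inv X).
have sφ : src (Tot (passoc X)) = pact X ∘ fmap T m ∘ fmap T e.
  by rewrite -comp1A -fmap_comp me.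
have tφ : tgt (Tot (passoc X)) = m ∘ (e ∘ mμ T X) by rewrite comp1A me.
have [ξ [ψ [ψ' [iψ sψ tψ ξe ψe]]]] := fillT hEM (hT _ _ _ He) Hm iφ sφ tφ.
have mn : m ∘ (e ∘ mι T X) = id1 X by rewrite comp1A me pact_unit.
have rn : isomorphic ((e ∘ mι T X) ∘ m) (id1 I).
  (* Rigidity is applied to the strict equality [m n = id]. *)
  apply: (EFS_rigid hEM Hm); rewrite mn; exists (id2 _).
  by exists (id2 _); rewrite vcomp_id_l.
have [α [α' [R mα αn]]] := retr_equiv_adjoint mn rn.
eexists; eexists; split.
  exact: (image_hom_universal hEM hT He Hm me iψ sψ tψ ξe ψe erefl R mα αn).
exact: image_hom_equivalence.
Qed.

Theorem theorem0p1 (K : TwoCat) (E M : cell1_class K) (T : TwoMonad K)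
    (hEFS : is_rigid_EFS E M) (hT : preserves_class T E) :
  exists (St : TwoFunctor (PsAlg T) (AlgSt T))
         (adj : TwoAdjunction St (inclusion T)),
    forall X : PsAlg T, is_internal_equivalence (adj_unit adj X).
Proof.
(* Choice over all pseudoalgebras at once; the algebra and its unit are selected as one dependent
   pair. *)
have [F HF] : exists F : forall X : PsAlgebra T,
    {A : StAlgebra T & PsHom X (st_ps A)}, forall X,
    @is_universal_arrow (PsAlg T) (AlgSt T) (inclusion T) X _ (projT2 (F X)) /\
    @is_internal_equivalence (PsAlg T) X (st_ps _) (projT2 (F X)).
  have H X : exists A : {A : StAlgebra T & PsHom X (st_ps A)},
      @is_universal_arrow (PsAlg T) (AlgSt T) (inclusion T) X _ (projT2 A) /\
      @is_internal_equivalence (PsAlg T) X (st_ps _) (projT2 A).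
    by have [A [η Hη]] := strictification_ex hEFS hT X; exists (existT _ A η).
  exists (fun X => proj1_sig (constructive_indefinite_description _ (H X))).
  by move=> X; case: constructive_indefinite_description.
pose U X := (HF X).1.
exists (ladj U), (ladj_adjunction U) => X.
exact: (HF X).2.
Qed.
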